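(* With the notation of the context, $$\alpha^*(G_v(\Lambda,x))=\pi_0^{-(p-1)w(\beta)}\bigg(\prod_{j=1}^N\frac{H(-v_j)}{[v_j']_{pv_j-v_j'}}\bigg)G_{v'}(\Lambda,x).$$
   Context: For $z\in\mathbb{C}_p$, $l\in\mathbb{Z}$ put $[z]_0=1$; $[z]_l=\frac{1}{(z+1)\cdots(z+l)}$ if $l>0$ and $z\notin\{-1,\dots,-l\}$; $[z]_l=z(z-1)\cdots(z+l+1)$ if $l<0$. Also $(z)_l=z(z+1)\cdots(z+l-1)$ for $l\ge0$. Let $A=\{\mathbf{a}_1,\dots,\mathbf{a}_N\}\subset\mathbb{Z}^n$ lie on a hyperplane $w(u)=1$, $w$ a linear form on $\mathbb{R}^n$ with rational coefficients; $\mathbb{Z}A$, $\mathbb{Q}A$ are the group and $\mathbb{Q}$-space generated by $A$, $C(A)$ the real cone generated by $A$, and $-C(A)^\circ$ the relative interior of $-C(A)$. Fix $Q\in\mathbb{Q}A$, $\beta\in(Q+\mathbb{Z}A)\cap(-C(A)^\circ)$, and $v=(v_1,\dots,v_N)\in\mathbb{Q}^N$ with all $v_j\in[-1,0]$ and $\beta=\sum_jv_j\mathbf{a}_j$. Fix a prime $p$ for which all $v_j$ are $p$-integral. Let $v_j'$ be the unique rational number in $[-1,0]$ with $pv_j-v_j'\in\{0,-1,\dots,-(p-1)\}$; put $v'=(v_1',\dots,v_N')$, $\beta'=\sum_jv_j'\mathbf{a}_j$. (One has $v_j'=-1$ iff $v_j=-1$, $v_j'=0$ iff $v_j=0$.)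 $\mathbb{C}_p$ is the completion of an algebraic closure of $\mathbb{Q}_p$, with norm $|\cdot|$ and valuation $\mathrm{ord}$, $\mathrm{ord}\,p=1$. Let $\pi_0\in\mathbb{C}_p$ be a root of $\sum_{i\ge0}t^{p^i}/p^i=0$ with $\mathrm{ord}\,\pi_0=1/(p-1)$. Fix a positive integer $d$ with $dv_j\in\mathbb{Z}$ for all $j$ and a $d$-th root of $\pi_0$, which defines $\pi_0^r$ for $r\in\frac1d\mathbb{Z}$. Let $\theta(t)=\exp(\sum_{i\ge0}(\pi_0t)^{p^i}/p^i)$, $\hat\theta(t)=\prod_{j\ge0}\theta(t^{p^j})$, $\hat\theta_1(t)=\hat\theta(t)/\exp(\pi_0t)=\sum_{i\ge0}\hat\theta_{1,i}(\pi_0t)^i/i!$. Let $\exp(\pi_0t-\pi_0t^p)=\sum_{i\ge0}\sigma_it^i$ and $H(z)=\sum_{l\ge0}(-1)^l(z)_l\,\sigma_{pl}\,\pi_0^{-l}$, which converges for $z\in\mathbb{Z}_p$. Let $E=\{l\in\mathbb{Z}^N\mid l_j\le0\text{ if }v_j=-1,\ l_j\ge0\text{ if }v_j=0\}$ and $E_+=\{l\in\mathbb{Z}^N\mid l_j\ge0\text{ if }v_j=0\}$. For $l\in\mathbb{Z}$ (with $l\le0$ if $v_j=-1$) set $g(v_j,l)=\sum_{i\ge0}[v_j]_{l-i}\hat\theta_{1,i}/i!$ (a convergent sum), and define $g(v'_j,l)$ likewise with $v_j'$ in place of $v_j$. For $u\in\beta+\mathbb{Z}A$ put $$G_u(\Lambda)=\sum_{l\in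 E,\ \sum_j(v_j+l_j)\mathbf{a}_j=u}\bigg(\prod_{j=1}^Ng(v_j,l_j)\bigg)\Lambda^{v+l},\qquad G_v(\Lambda,x)=\sum_{u\in\beta+\mathbb{Z}A}G_u(\Lambda)\pi_0^{w(u)}x^u.$$ For $u'\in\beta'+\mathbb{Z}A$ define $G_{u'}(\Lambda)$ and $G_{v'}(\Lambda,x)=\sum_{u'\in\beta'+\mathbb{Z}A}G_{u'}(\Lambda)\pi_0^{w(u')}x^{u'}$ by the same formulas with $v,\beta$ replaced by $v',\beta'$ (the set $E$ is unchanged). For $S\subseteq\mathbb{Z}^N$ let $C_S\{\Lambda_1x^{\mathbf{a}_1},\dots,\Lambda_Nx^{\mathbf{a}_N}\}$ be the space of formal series $\sum_{l\in S}c_l\prod_j(\Lambda_jx^{\mathbf{a}_j})^{l_j}$, $c_l\in\mathbb{C}_p$, such that for every $0<\delta<1$, $|c_l|\delta^{|l_1|+\dots+|l_N|}\to0$ (i.e. for each $\epsilon>0$ it is $<\epsilon$ for all but finitely many $l$); for $S=\mathbb{Z}^N$ write $C\{\cdots\}$. Then $G_v(\Lambda,x)\in\Lambda^vx^\beta C_E\{\Lambda_1x^{\mathbf{a}_1},\dots\}$ and $G_{v'}(\Lambda,x)\in\Lambda^{v'}x^{\beta'}C_E\{\Lambda_1x^{\mathbf{a}_1},\dots\}$. The map $$\alpha^*=\gamma_E\circ\theta(\Lambda,x)\circ\Phi^*:\Lambda^vx^\beta C_E\{\Lambda_1x^{\mathbf{a}_1},\dots,\Lambda_Nx^{\mathbf{a}_N}\}\to\Lambda^{v'}x^{\beta'}C_E\{\Lambda_1x^{\mathbf{a}_1},\dots,\Lambda_Nx^{\mathbf{a}_N}\}$$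 is the composition of: $\Phi^*$, replacing each $\Lambda_j$ by $\Lambda_j^p$ and each $x_i$ by $x_i^p$; multiplication by $\theta(\Lambda,x)=\prod_{j=1}^N\theta(\Lambda_jx^{\mathbf{a}_j})$ (landing in $\Lambda^{v'}x^{\beta'}C_{E_+}\{\cdots\}$); and $\gamma_E$, which sends $\Lambda^{v'}x^{\beta'}\sum_{l\in\mathbb{Z}^N}c_l\prod_j(\Lambda_jx^{\mathbf{a}_j})^{l_j}$ to $\Lambda^{v'}x^{\beta'}\sum_{l\in E}c_l\prod_j(\Lambda_jx^{\mathbf{a}_j})^{l_j}$. *)

(* Defs.v *)
From HB Require Import structures.
From mathcomp Require Import all_boot all_order all_algebra finmap.
From mathcomp Require Import all_classical all_reals all_analysis.
From mathcomp.analysis Require summability.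

Set Implicit Arguments.
Unset Strict Implicit.
Unset Printing Implicit Defensive.

Import Order.TTheory GRing.Theory Num.Theory.
Import numFieldNormedType.Exports.

Local Open Scope classical_set_scope.
Local Open Scope ring_scope.

(* The norm of a normedZmodType satisfies |n x| = n |x|, which excludes
   non-archimedean absolute values; hence this separate structure. *)
Record valuedField (R : realType) := ValuedField {
  vf_field : fieldType ;
  vabs : vf_field -> R ;
  vabs_ge0 : forall x, 0 <= vabs x ;
  vabs_eq0 : forall x, (vabs x == 0) = (x == 0) ;
  vabsM : forall x y, vabs (x * y) = vabs x * vabs y ;
  vabsD_max : forall x y, vabs (x + y) <= Num.max (vabs x) (vabs y)
}.

Definition vf_sort (R : realType) (K : valuedField R) : Type := vf_field K.
Coercion vf_sort : valuedField >-> Sortclass.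

Section valued_field_instances.
Context (R : realType) (K : valuedField R).

HB.instance Definition _ := GRing.Field.copy (vf_sort K) (vf_field K).

Definition vdist (x y : vf_sort K) : R := vabs (x - y).

Let vabs0 : vabs (0 : vf_field K) = 0.
Proof. by apply/eqP; rewrite vabs_eq0. Qed.

Let vabs1 : vabs (1 : vf_field K) = 1.
Proof.
have n0 : vabs (1 : vf_field K) != 0 by rewrite vabs_eq0 oner_neq0.
by apply: (mulfI n0); rewrite -vabsM !mulr1.
Qed.

Let vabsN (x : vf_field K) : vabs (- x) = vabs x.
Proof.
suff N1 : vabs (- 1 : vf_field K) = 1 by rewrite -mulN1r vabsM N1 mul1r.
by apply: (@pexpIrn _ 2) => //; rewrite ?nnegrE ?vabs_ge0//
  expr1n expr2 -vabsM mulrNN mulr1 vabs1.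
Qed.

Let vdistxx x : vdist x x = 0.
Proof. by rewrite /vdist subrr vabs0. Qed.

Let vdist_positivity x y : vdist x y = 0 -> x = y.
Proof. by move/eqP; rewrite vabs_eq0 subr_eq0 => /eqP. Qed.

Let vdist_sym x y : vdist x y = vdist y x.
Proof. by rewrite /vdist -opprB vabsN. Qed.

Let vdist_triangle y x z : vdist x z <= vdist x y + vdist y z.
Proof.
rewrite /vdist -(subrKA y x (- z)); apply: le_trans (vabsD_max _ _) _.
by rewrite ge_max lerDl lerDr !vabs_ge0.
Qed.

HB.instance Definition _ := isMetric.Build R (vf_sort K)
  vdistxx vdist_positivity vdist_sym vdist_triangle.
HB.instance Definition _ := isPointed.Build (vf_sort K) 0.

(* In a complete K whose absolute value extends the p-adic one, the closure of
   the prime field is a copy of Q_p. *)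
Definition Qp : set K := closure (range (ratr : rat -> K)).

Definition poly_in (S : set K) (q : {poly K}) : Prop := forall i, S q`_i.

Definition Qpbar : set K :=
  [set x | exists q : {poly K}, [/\ q != 0, poly_in Qp q & root q x]].

End valued_field_instances.

(* The completion of an algebraic closure of Q_p, given by its definition: the
   absolute value is non-archimedean with |p| = 1/p (so it is the p-adic one on
   rationals), the elements algebraic over Q_p form an algebraically closed
   field, and they are dense in the complete field K. *)
Record padicComplex (R : realType) (p : nat) := PadicComplex {
  Cp_valued :> valuedField R ;
  Cp_vabsp : vabs (p%:R : Cp_valued) = (p%:R : R)^-1 ;
  Cp_complete : forall F : set_system Cp_valued,
    ProperFilter F -> cauchy F -> cvg F ;
  Cp_Qpbar_closed : forall q : {poly Cp_valued},
    poly_in (@Qpbar R Cp_valued) q -> (1 < size q)%N ->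
    exists2 x, @Qpbar R Cp_valued x & root q x ;
  Cp_Qpbar_dense : dense (@Qpbar R Cp_valued)
}.

Section sums.
Context (R : realType) (p : nat) (K : padicComplex R p).

(* ord 0 is 0, a junk value, since the library sets ln 0 = 0. *)
Definition ord (x : K) : R := - ln (vabs x) / ln p%:R.

Definition sumn_inf (u : nat -> K) : K := limn (series u).

(* Limit of the net of finite partial sums: the order of summation plays no
   role. *)
Definition sum_inf (I : choiceType) (u : I -> K) : K :=
  lim (summability.partial_sum u @ summability.totally).

End sums.

Section power_series.
Context (K : fieldType).
Implicit Types f g : nat -> K.

Definition ps_one : nat -> K := fun i => (i == 0)%:R.

Definition ps_monomial (c : K) (m : nat) : nat -> K := fun i => c *+ (i == m).

Definition ps_sub f g : nat -> K := fun i => f i - g i.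

Definition ps_mul f g : nat -> K := fun i => \sum_(j < i.+1) f j * g (i - j)%N.

Definition ps_pow f (k : nat) : nat -> K := iter k (ps_mul f) ps_one.

(* f(t^m) for m > 0 *)
Definition ps_subst_pow (m : nat) f : nat -> K :=
  fun i => if (m %| i)%N then f (i %/ m)%N else 0.

(* \sum_k c_k f^k for f without constant term; as f^k = O(t^k), only the terms
   with k <= i contribute to the coefficient of t^i. *)
Definition ps_comp (c : nat -> K) f : nat -> K :=
  fun i => \sum_(k < i.+1) c k * ps_pow f k i.

Definition ps_exp f : nat -> K := ps_comp (fun k => (k`!%:R)^-1) f.

(* 1/f for f with constant term 1, by the geometric series in 1 - f *)
Definition ps_inv f : nat -> K := ps_comp (fun=> 1) (ps_sub ps_one f).

End power_series.

Section brackets.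
Context (K : fieldType).

(* [z]_l; since 0^-1 = 0, it is 0 in the excluded case where l > 0 and z is one
   of -1, ..., -l. Recall that Negz m stands for - m.+1. *)
Definition bracket (z : K) (l : int) : K :=
  match l with
  | Posz m => (\prod_(1 <= i < m.+1) (z + i%:R))^-1
  | Negz m => \prod_(0 <= i < m.+1) (z - i%:R)
  end.

Definition pochhammer (z : K) (l : nat) : K := \prod_(i < l) (z + i%:R).

End brackets.

Section dwork.
Context (R : realType) (p : nat) (K : padicComplex R p) (pi0 : K).

(* \sum_i (pi0 t)^(p^i) / p^i; note that p^i = m forces i <= m. *)
Definition theta_log : nat -> K :=
  fun m => \sum_(i < m.+1 | (p ^ i == m)%N) pi0 ^+ m / (p ^ i)%:R.

Definition theta : nat -> K := ps_exp theta_log.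

(* \prod_(j >= 0) theta(t^(p^j)): as theta(t^(p^j)) = 1 + O(t^(p^j)), only the
   factors with j <= i contribute to the coefficient of t^i. *)
Definition theta_hat : nat -> K := fun i =>
  (\big[@ps_mul K/@ps_one K]_(j < i.+1) ps_subst_pow (p ^ j) theta) i.

Definition theta_hat1_series : nat -> K :=
  ps_mul theta_hat (ps_inv (ps_exp (ps_monomial pi0 1))).

(* theta_hat1_series = \sum_i theta_hat1 i (pi0 t)^i / i! *)
Definition theta_hat1 (i : nat) : K :=
  theta_hat1_series i * (i`!)%:R / pi0 ^+ i.

Definition g (z : rat) (l : int) : K :=
  sumn_inf (fun i => bracket (ratr z : K) (l - i%:Z) * theta_hat1 i / (i`!)%:R).

Definition sigma : nat -> K :=
  ps_exp (ps_sub (ps_monomial pi0 1) (ps_monomial pi0 p)).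

Definition H (z : K) : K :=
  sumn_inf (fun l => (-1) ^+ l * pochhammer z l * sigma (p * l)%N / pi0 ^+ l).

End dwork.

Section cones.
Context (R : realType) (n : nat).

Definition affine_hull (S : set 'rV[R]_n) : set 'rV[R]_n :=
  [set x | exists m (t : 'I_m -> R) (s : 'I_m -> 'rV[R]_n),
    [/\ forall i, S (s i), \sum_i t i = 1 & x = \sum_i t i *: s i]].

Definition relative_interior (S : set 'rV[R]_n) : set 'rV[R]_n :=
  [set x | S x /\ within (affine_hull S) (nbhs x) S].

Definition cone (N : nat) (a : 'M[int]_(N, n)) : set 'rV[R]_n :=
  [set x | exists2 c : 'rV[R]_N,
    (forall j, 0 <= c 0 j) & x = c *m map_mx intr a].

Definition opp_cone (N : nat) (a : 'M[int]_(N, n)) : set 'rV[R]_n :=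
  [set - x | x in cone a].

End cones.
Arguments opp_cone R {n N} a.

(* F e u is the coefficient of Lambda^e x^u; exponents are rational. The vector
   a_j is the j-th row of the matrix a, so \sum_j e_j a_j is e *m a. *)
Definition fseries (K : Type) (N n : nat) := 'rV[rat]_N -> 'rV[rat]_n -> K.

Section series.
Context (R : realType) (p : nat) (K : padicComplex R p) (N n : nat).
Context (a : 'M[int]_(N, n)) (w : 'cV[rat]_n).

Definition ratv (m : nat) (l : 'rV[int]_m) : 'rV[rat]_m := map_mx intr l.

Definition natv (m : nat) (k : 'rV[nat]_m) : 'rV[rat]_m :=
  map_mx (fun i : nat => i%:R) k.

Definition wsum (e : 'rV[rat]_N) : 'rV[rat]_n := e *m map_mx intr a.

Definition wform (u : 'rV[rat]_n) : rat := (u *m w) 0 0.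

Definition fscale (c : K) (F : fseries K N n) : fseries K N n :=
  fun e u => c * F e u.

Definition E_of (v : 'rV[rat]_N) : set 'rV[int]_N :=
  [set l | forall j, (v 0 j = -1 -> l 0 j <= 0) /\ (v 0 j = 0 -> 0 <= l 0 j)].

(* pi0 ^ r for r in (1/d)Z, where rho is the chosen d-th root of pi0 *)
Definition root_pow (rho : K) (d : nat) (r : rat) : K :=
  rho ^ (Num.floor (d%:R * r)).

(* The coefficient of Lambda^e in G_u(Lambda); the index set of the sum has at
   most one element. *)
Definition Gcoef (pi0 : K) (E : set 'rV[int]_N) (v : 'rV[rat]_N)
    (u : 'rV[rat]_n) (e : 'rV[rat]_N) : K :=
  \sum_(l \in [set l | [/\ E l, wsum (v + ratv l) = u & v + ratv l = e]])
    \prod_(j < N) g pi0 (v 0 j) (l 0 j).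

Definition Gseries (pi0 rho : K) (d : nat) (E : set 'rV[int]_N)
    (v : 'rV[rat]_N) (beta : 'rV[rat]_n) : fseries K N n :=
  fun e u => if `[< exists l, u = beta + wsum (ratv l) >]
             then Gcoef pi0 E v u e * root_pow rho d (wform u) else 0.

Definition Phi_star (F : fseries K N n) : fseries K N n :=
  fun e u => F ((p%:R)^-1 *: e) ((p%:R)^-1 *: u).

(* Multiplication by \prod_j theta(Lambda_j x^(a_j)), whose coefficient at
   Lambda^k x^(\sum_j k_j a_j) is \prod_j theta_(k_j) *)
Definition mul_theta (pi0 : K) (F : fseries K N n) : fseries K N n :=
  fun e u => sum_inf (fun k : 'rV[nat]_N =>
    (\prod_(j < N) theta pi0 (k 0 j)) * F (e - natv k) (u - wsum (natv k))).

Definition gamma (E : set 'rV[int]_N) (v : 'rV[rat]_N) (beta : 'rV[rat]_n)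
    (F : fseries K N n) : fseries K N n :=
  fun e u => if `[< exists l, [/\ E l, e = v + ratv l
                               & u = beta + wsum (ratv l)] >]
             then F e u else 0.

(* Phi_star, mul_theta and gamma are given by their formulas on all formal
   series; on the spaces of series satisfying the growth condition of the source
   space, the sums in mul_theta converge. v' and beta' give the monomial factored
   out in the target space. *)
Definition alpha_star (pi0 : K) (E : set 'rV[int]_N) (v' : 'rV[rat]_N)
    (beta' : 'rV[rat]_n) (F : fseries K N n) : fseries K N n :=
  gamma E v' beta' (mul_theta pi0 (Phi_star F)).

End series.

(* Main.v *)
(* With q_m = [v]_m pi0^m, the bilateral series Q_v(t) = sum_m q_m t^(v+m) is a
   formal analogue of exp(pi0 t): it is annihilated by t d/dt - pi0 t, up to
   truncation when v = -1. The coefficients g(v, m) pi0^m are those of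
   theta_hat1(t) Q_v(t). Since w(a_j) = 1, the coefficients of alpha^*(G_v) factor
   over the variables, so everything reduces to
     theta(t) theta_hat1(t^p) Q_v(t^p) = const * theta_hat1(t) Q_v'(t).
   From theta_hat(t) = theta(t) theta_hat(t^p) one gets theta(t) theta_hat1(t^p) =
   theta_hat1(t) exp(pi0 t - pi0 t^p), and exp(pi0 t - pi0 t^p) Q_v(t^p) satisfies
   the first order recurrence of Q_v'(t), hence is a multiple of it; comparing the
   coefficients of t^(pv) gives the constant. The products of bilateral series
   converge and are associative because theta, theta_hat1 and
   exp(pi0 t - pi0 t^p) have geometrically decreasing coefficients, while
   |q_m| = O(1 + |m|). The decrease for theta is the integrality of the
   Artin-Hasse exponential. *)

(* The recurrence (pv + n) y_n = pi0 y_(n-1) propagates downwards freely, but upwards only while pv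
   + n is nonzero. For v in [-1, 0] the only obstruction at n > 0 is v = -1, n = p. So the
   recurrence is used only for n <= max(l + c, 0), where c = v' - pv: when v = -1 the projection
   [gamma] keeps only l <= 0, whence n <= c < p. When v = 0 the truncation is harmless because g(0,
   l) = 0 for l < 0. The number |pi0| = p^(-1/(p-1)) is exactly the radius of convergence of exp, so
   a direct estimate of exp(pi0 t - pi0 t^p) yields only bounded coefficients. In log theta_hat the
   coefficient of t^(p^j) is a partial sum of the series that vanishes at pi0; being minus a tail,
   it is small for j >= 1, and dividing by exp(pi0 t) removes the one with j = 0. This gives the
   decrease for theta_hat1, and the one for exp(pi0 t - pi0 t^p) is deduced from theta(t)
   theta_hat1(t^p) = theta_hat1(t) exp(pi0 t - pi0 t^p) by inverting theta_hat1. *)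
Require Import Defs.
From HB Require Import structures.
From mathcomp Require Import all_boot all_order all_algebra finmap.
From mathcomp Require Import all_classical all_reals all_analysis.
From mathcomp.analysis Require summability.
From mathcomp Require Import ring lra zify.
Import Order.TTheory GRing.Theory Num.Theory.
Import numFieldNormedType.Exports.
Local Open Scope classical_set_scope.
Local Open Scope ring_scope.
Set Implicit Arguments.
Unset Strict Implicit.
Unset Printing Implicit Defensive.

(** * Formal power series *)

Section fps_ring.
Context (K : fieldType).
Implicit Types f g h : nat -> K.

(** Since coefficient i of a product depends only on coefficients up to i, the ring axioms are
    inherited from polynomials by truncation. *)
Lemma ps_mul_coef f g (P Q : {poly K}) i :
  (forall j, (j <= i)%N -> f j = P`_j) -> (forall j, (j <= i)%N -> g j = Q`_j) ->
  ps_mul f g i = (P * Q)`_i.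
Proof.
move=> fP gQ; rewrite coefM; apply: eq_bigr => j _.
by rewrite fP ?gQ ?leq_subr// -ltnS.
Qed.

Definition ps_trunc f n : {poly K} := \poly_(i < n.+1) f i.

Lemma coef_ps_trunc f n j : (j <= n)%N -> f j = (ps_trunc f n)`_j.
Proof. by rewrite coef_poly ltnS => ->. Qed.

Lemma ps_mulA : associative (@ps_mul K).
Proof.
move=> f g h; apply/funext => i.
rewrite (ps_mul_coef (P := ps_trunc f i) (Q := ps_trunc g i * ps_trunc h i)).
- rewrite mulrA (ps_mul_coef (P := ps_trunc f i * ps_trunc g i) (Q := ps_trunc h i))//.
    by move=> j ji; apply: ps_mul_coef => k kj; apply: coef_ps_trunc; apply: leq_trans ji.
  by move=> j; exact: coef_ps_trunc.
- by move=> j; exact: coef_ps_trunc.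
- by move=> j ji; apply: ps_mul_coef => k kj; apply: coef_ps_trunc; apply: leq_trans ji.
Qed.

Lemma ps_mulC : commutative (@ps_mul K).
Proof.
move=> f g; apply/funext => i.
by rewrite !(ps_mul_coef (@coef_ps_trunc _ i) (@coef_ps_trunc _ i)) mulrC.
Qed.

Lemma ps_mul1 : left_id (@ps_one K) (@ps_mul K).
Proof.
move=> f; apply/funext => i; rewrite (ps_mul_coef (P := 1) (Q := ps_trunc f i)).
- by rewrite mul1r -coef_ps_trunc.
- by move=> j _; rewrite coef1.
- by move=> j; exact: coef_ps_trunc.
Qed.

Lemma ps_mulDl : left_distributive (@ps_mul K) +%R.
Proof.
move=> f g h; apply/funext => i.
have -> : (ps_mul f h + ps_mul g h) i = ps_mul f h i + ps_mul g h i by [].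
by rewrite /ps_mul -big_split/=; apply: eq_bigr => j _; rewrite -mulrDl.
Qed.

(** A type of its own, so that [*] can be the Cauchy product. *)
Definition fps : Type := nat -> K.

HB.instance Definition _ := GRing.Zmodule.copy fps (nat -> K).

Lemma ps_one_neq0 : (ps_one K : fps) != 0.
Proof.
by apply/eqP => /(congr1 (fun f : fps => f 0%N))/eqP; rewrite oner_eq0.
Qed.

HB.instance Definition _ := GRing.Zmodule_isComNzRing.Build fps
  ps_mulA ps_mulC ps_mul1 ps_mulDl ps_one_neq0.

End fps_ring.
Arguments ps_trunc {K} f n.

Section fps_theory.
Context (K : fieldType).
Implicit Types f g h u : fps K.

Lemma fpsM f g i : (f * g) i = \sum_(j < i.+1) f j * g (i - j)%N.
Proof. by []. Qed.

Lemma fps1 i : (1 : fps K) i = (i == 0)%:R. Proof. by []. Qed.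

Lemma fpsD f g i : (f + g) i = f i + g i. Proof. by []. Qed.

Lemma fpsN f i : (- f) i = - f i. Proof. by []. Qed.

Lemma fpsB f g i : (f - g) i = f i - g i. Proof. by []. Qed.

Lemma fpsMn f n i : (f *+ n) i = f i *+ n.
Proof. by elim: n => // n ih; rewrite !mulrS fpsD ih. Qed.

Lemma fps_sum (I : Type) (r : seq I) (P : pred I) (F : I -> fps K) i :
  (\sum_(j <- r | P j) F j) i = \sum_(j <- r | P j) F j i.
Proof. by elim/big_rec2: _ => // j y x _ <-. Qed.

Lemma fpsM0 f g : (f * g) 0%N = f 0%N * g 0%N.
Proof. by rewrite fpsM big_ord1. Qed.

Lemma fpsX0 f n : (f ^+ n) 0%N = f 0%N ^+ n.
Proof. by elim: n => // n ih; rewrite !exprS fpsM0 ih. Qed.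

Lemma ps_powE f k : ps_pow f k = f ^+ k.
Proof. by elim: k => // k ih; rewrite exprS /ps_pow iterS -/(ps_pow f k) ih. Qed.

Lemma fps_monomialM c m f i :
  ((ps_monomial c m : fps K) * f) i = if (m <= i)%N then c * f (i - m)%N else 0.
Proof.
rewrite fpsM; case: leqP => mi.
  rewrite (bigD1 (Ordinal (mi : (m < i.+1)%N)))//= {1}/ps_monomial eqxx mulr1n.
  rewrite big1 ?addr0// => j; rewrite -val_eqE /= /ps_monomial => /negPf ->.
  by rewrite mulr0n mul0r.
rewrite big1// => j _; rewrite /ps_monomial ltn_eqF ?mulr0n ?mul0r//.
by apply: leq_ltn_trans mi; rewrite -ltnS.
Qed.

Lemma fps_expr_lt f k i : f 0%N = 0 -> (i < k)%N -> (f ^+ k) i = 0.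
Proof.
move=> f0; elim: k i => // k ih i ik; rewrite exprS fpsM big1// => j _.
have [->|j0] := eqVneq (j : nat) 0%N; first by rewrite f0 mul0r.
by rewrite ih ?mulr0//; move: j0 (ltn_ord j) ik; lia.
Qed.

(** The derivation t d/dt, which does not shift indices. *)
Definition euler f : fps K := fun i => i%:R * f i.

Lemma eulerE f i : euler f i = i%:R * f i. Proof. by []. Qed.

Lemma eulerD f g : euler (f + g) = euler f + euler g.
Proof. by apply/funext => i; rewrite fpsD !eulerE fpsD mulrDr. Qed.

Lemma eulerN f : euler (- f) = - euler f.
Proof. by apply/funext => i; rewrite fpsN !eulerE fpsN mulrN. Qed.

Lemma eulerM f g : euler (f * g) = euler f * g + f * euler g.
Proof.
apply/funext => i; rewrite eulerE fpsD !fpsM big_distrr/= -big_split/=.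
apply: eq_bigr => j _; rewrite !eulerE.
have -> : i%:R = j%:R + (i - j)%N%:R :> K by rewrite -natrD subnKC// -ltnS.
by ring.
Qed.

Lemma eulerX f n : euler (f ^+ n) = euler f * f ^+ n.-1 *+ n.
Proof.
elim: n => [|n ih].
  by rewrite mulr0n expr0; apply/funext => -[|i]; rewrite eulerE ?mul0r// fps1 mulr0.
rewrite exprS eulerM ih mulrS; congr (_ + _).
by case: n {ih} => [|n]; rewrite ?mulr0n ?mulr0//= mulrnAr mulrCA -exprS.
Qed.

Lemma ps_subst_powE m f n i : (0 < m)%N -> (i <= n)%N ->
  ps_subst_pow m f i = (ps_trunc f n \Po 'X^m)`_i.
Proof.
move=> m0 ilen; rewrite coef_comp_poly_Xn// /ps_subst_pow; case: ifP => // _.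
by apply: coef_ps_trunc; apply: leq_trans (leq_div _ _) ilen.
Qed.

Lemma ps_subst_powM m f g : (0 < m)%N ->
  (ps_subst_pow m (f * g) : fps K) = (ps_subst_pow m f : fps K) * (ps_subst_pow m g : fps K).
Proof.
move=> m0; apply/funext => i.
rewrite [RHS](ps_mul_coef (P := ps_trunc f i \Po 'X^m) (Q := ps_trunc g i \Po 'X^m)).
- rewrite -rmorphM/= coef_comp_poly_Xn// /ps_subst_pow; case: ifP => // _.
  by rewrite -(@ps_mul_coef _ f g)// => j ji; apply: coef_ps_trunc;
    apply: leq_trans ji (leq_div _ _).
- by move=> j ji; apply: ps_subst_powE.
- by move=> j ji; apply: ps_subst_powE.
Qed.

Lemma ps_subst_pow1 m : (0 < m)%N -> (ps_subst_pow m (1 : fps K) : fps K) = 1.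
Proof.
move=> m0; apply/funext => i; rewrite /ps_subst_pow; case: ifPn => [/dvdnP[k ->]|].
  by rewrite mulnK// !fps1 muln_eq0 [m == _]eqn0Ngt m0 orbF.
by rewrite fps1; case: i => //; rewrite dvdn0.
Qed.

Lemma ps_subst_powX m f n : (0 < m)%N ->
  (ps_subst_pow m (f ^+ n) : fps K) = (ps_subst_pow m f : fps K) ^+ n.
Proof.
by move=> m0; elim: n => [|n ih]; rewrite ?ps_subst_pow1// !exprS ps_subst_powM// ih.
Qed.

Definition fps_exp f : fps K := ps_exp f.

(** As f^k = O(t^k), any bound n >= i gives the same sum; a common bound lets sums for different
    coefficients be compared and exchanged. *)
Lemma fps_expE f n i : f 0%N = 0 -> (i <= n)%N ->
  fps_exp f i = \sum_(k < n.+1) (f ^+ k) i / (k`!)%:R.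
Proof.
move=> f0 ilen; rewrite /fps_exp /ps_exp /ps_comp.
rewrite (big_ord_widen_cond n.+1 xpredT (fun k => (k`!)%:R^-1 * ps_pow f k i))//.
rewrite big_mkcond/=; apply: eq_bigr => k _; rewrite ps_powE mulrC.
by case: ltnP => // ik; rewrite fps_expr_lt ?mul0r.
Qed.

Lemma fps_exp0 f : f 0%N = 0 -> fps_exp f 0%N = 1.
Proof. by move=> f0; rewrite (fps_expE f0 (leqnn 0)) big_ord1 expr0 fps1 divr1. Qed.

Section char0.
Hypothesis natr_eq0K : forall n, (n%:R == 0 :> K) = (n == 0)%N.

Lemma euler_fps_exp f : f 0%N = 0 -> euler (fps_exp f) = euler f * fps_exp f.
Proof.
move=> f0; apply/funext => i.
rewrite eulerE (fps_expE f0 (leqnn i)) big_distrr/= big_ord_recl/=.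
rewrite [X in X + _](_ : _ = 0) ?add0r; last first.
  by case: i => [|i]; rewrite ?mul0r ?mulr0.
rewrite fpsM.
under eq_bigr => k _ do rewrite mulrA -eulerE eulerX fpsMn fpsM /bump/= add1n.
under [RHS]eq_bigr => j _ do rewrite (fps_expE f0 (leq_subr j i)) mulr_sumr.
rewrite exchange_big/= big_ord_recr/= [X in _ = _ + X]big1 ?addr0; last first.
  move=> j _; have [->|j0] := eqVneq (j : nat) 0%N; first by rewrite eulerE !mul0r.
  by rewrite fps_expr_lt ?mul0r ?mulr0//; move: j0 (ltn_ord j); lia.
apply: eq_bigr => k _; rewrite -[X in X / _]mulr_natr -mulrA big_distrl/=.
have -> : k.+1%:R / (k.+1)`!%:R = (k`!)%:R^-1 :> K.
  by rewrite factS natrM invfM mulrA divff ?mul1r// natr_eq0K.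
by apply: eq_bigr => j _; rewrite mulrA.
Qed.

(** As u has no constant term, coefficient i + 1 of u f involves only f_0, ..., f_i, and i + 1 can
    be cancelled in characteristic 0. *)
Lemma euler_uniq u f g : u 0%N = 0 -> f 0%N = g 0%N ->
  euler f = u * f -> euler g = u * g -> f = g.
Proof.
move=> u0 fg0 Ef Eg; apply/funext => i; elim/ltn_ind: i => -[_ //|i ih].
have : euler f i.+1 = euler g i.+1.
  rewrite Ef Eg !fpsM; apply: eq_bigr => j _.
  have [->|j0] := eqVneq (j : nat) 0%N; first by rewrite u0 !mul0r.
  by rewrite ih//; move: j0; lia.
by rewrite !eulerE; apply: mulfI; rewrite natr_eq0K.
Qed.

Lemma fps_expD f g : f 0%N = 0 -> g 0%N = 0 ->
  fps_exp (f + g) = fps_exp f * fps_exp g.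
Proof.
move=> f0 g0; have fg0 : (f + g) 0%N = 0 by rewrite fpsD f0 g0 addr0.
apply: (@euler_uniq (euler (f + g))).
- by rewrite eulerE mul0r.
- by rewrite fpsM0 !fps_exp0// mulr1.
- exact: euler_fps_exp.
- by rewrite eulerM !euler_fps_exp// eulerD mulrDl mulrCA !mulrA.
Qed.

Lemma fps_exp_0 : fps_exp 0 = 1.
Proof.
apply: (@euler_uniq 0) => //; rewrite ?fps_exp0//.
  by rewrite euler_fps_exp// (_ : euler 0 = 0)//; apply/funext => i; rewrite eulerE mulr0.
by rewrite mul0r; apply/funext => -[|i]; rewrite eulerE ?mul0r// fps1 mulr0.
Qed.

Lemma fps_expN f : f 0%N = 0 -> fps_exp f * fps_exp (- f) = 1.
Proof. by move=> f0; rewrite -fps_expD ?fpsN ?f0 ?oppr0// subrr fps_exp_0. Qed.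

Lemma fps_expX f n : f 0%N = 0 -> fps_exp (f *+ n) = fps_exp f ^+ n.
Proof.
move=> f0; elim: n => [|n ih]; first by rewrite mulr0n fps_exp_0.
by rewrite mulrS fps_expD// ?ih ?exprS// fpsMn f0 mul0rn.
Qed.

End char0.

Lemma fps_exp_subst m f : (0 < m)%N -> f 0%N = 0 ->
  (ps_subst_pow m (fps_exp f) : fps K) = fps_exp (ps_subst_pow m f).
Proof.
move=> m0 f0; apply/funext => i.
have sf0 : (ps_subst_pow m f : fps K) 0%N = 0 by rewrite /ps_subst_pow dvdn0 div0n.
rewrite (fps_expE sf0 (leqnn i)).
under eq_bigr => k _ do rewrite -ps_subst_powX//.
rewrite /ps_subst_pow; case: ifP => _; last by rewrite big1// => k _; rewrite mul0r.
by rewrite (fps_expE f0 (leq_div i m)).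
Qed.

Lemma fps_exp_ext f g n : f 0%N = 0 -> g 0%N = 0 ->
  (forall i, (i <= n)%N -> f i = g i) -> fps_exp f n = fps_exp g n.
Proof.
move=> f0 g0 fg.
have fgX k j : (j <= n)%N -> (f ^+ k) j = (g ^+ k) j.
  elim: k j => // k ih j jn; rewrite !exprS !fpsM; apply: eq_bigr => i _.
  have ij : (i <= j)%N by rewrite -ltnS.
  by rewrite fg ?(leq_trans ij)// ih// (leq_trans (leq_subr _ _)).
rewrite (fps_expE f0 (leqnn n)) (fps_expE g0 (leqnn n)).
by apply: eq_bigr => k _; rewrite fgX.
Qed.

Definition fps_scale (c : K) f : fps K := fun i => c ^+ i * f i.

Lemma fps_scaleX c f n : fps_scale c (f ^+ n) = fps_scale c f ^+ n.
Proof.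
elim: n => [|n ih].
  by rewrite !expr0; apply/funext => -[|i]; rewrite /fps_scale !fps1 ?expr0 ?mulr1// mulr0.
rewrite !exprS -ih; apply/funext => i; rewrite /fps_scale !fpsM mulr_sumr.
apply: eq_bigr => j _.
have -> : c ^+ i = c ^+ j * c ^+ (i - j) by rewrite -exprD subnKC// -ltnS.
by ring.
Qed.

Lemma fps_exp_scale c f : f 0%N = 0 ->
  fps_exp (fps_scale c f) = fps_scale c (fps_exp f).
Proof.
move=> f0; apply/funext => i.
have cf0 : fps_scale c f 0%N = 0 by rewrite /fps_scale f0 mulr0.
rewrite (fps_expE cf0 (leqnn i)) /fps_scale (fps_expE f0 (leqnn i)) mulr_sumr.
by apply: eq_bigr => k _; rewrite -fps_scaleX /fps_scale mulrA.
Qed.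

(** The geometric sum telescopes to 1 - (1 - f)^(i+1), whose second term does not reach t^i. *)
Lemma ps_invE f : f 0%N = 1 -> f * (ps_inv f : fps K) = 1.
Proof.
move=> f0; set g : fps K := 1 - f.
have g0 : g 0%N = 0 by rewrite /g fpsB f0 fps1 subrr.
have Ei n i : (i <= n)%N -> ps_inv f i = (\sum_(k < n.+1) g ^+ k) i.
  move=> ilen; rewrite /ps_inv /ps_comp fps_sum.
  rewrite (big_ord_widen_cond n.+1 xpredT (fun k => 1 * ps_pow g k i))// big_mkcond/=.
  apply: eq_bigr => k _; rewrite ps_powE mul1r.
  by case: ltnP => // ik; rewrite fps_expr_lt.
apply/funext => i.
have -> : (f * (ps_inv f : fps K)) i = (f * \sum_(k < i.+1) g ^+ k) i.
  by rewrite !fpsM; apply: eq_bigr => j _; rewrite (Ei i)// leq_subr.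
have -> : f = - (g - 1) by rewrite /g; ring.
by rewrite mulNr -subrX1 opprB fpsB fps_expr_lt ?subr0.
Qed.

End fps_theory.

(** * Non-archimedean absolute values and geometrically convergent sums *)

Section vabs_theory.
Context (R : realType) (K : valuedField R).
Implicit Types x y : K.

Lemma vn_ge0 x : 0 <= vabs x. Proof. exact: vabs_ge0. Qed.

Lemma vn_eq0 x : (vabs x == 0) = (x == 0). Proof. exact: vabs_eq0. Qed.

Lemma vnM x y : vabs (x * y) = vabs x * vabs y. Proof. exact: vabsM. Qed.

Lemma vn0 : vabs (0 : K) = 0. Proof. by apply/eqP; rewrite vn_eq0. Qed.

Lemma vn1 : vabs (1 : K) = 1.
Proof.
have n0 : vabs (1 : K) != 0 by rewrite vn_eq0 oner_neq0.
by apply: (mulfI n0); rewrite -vnM !mulr1.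
Qed.

Lemma vnX x n : vabs (x ^+ n) = vabs x ^+ n.
Proof. by elim: n => [|n ih]; rewrite ?vn1// !exprS vnM ih. Qed.

Lemma vnN x : vabs (- x) = vabs x.
Proof.
suff N1 : vabs (- 1 : K) = 1 by rewrite -mulN1r vnM N1 mul1r.
by apply: (@pexpIrn _ 2) => //; rewrite ?nnegrE ?vn_ge0// -vnX sqrrN !expr1n vn1.
Qed.

Lemma vnB x y : vabs (x - y) = vabs (y - x).
Proof. by rewrite -opprB vnN. Qed.

Lemma vn_gt0 x : (0 < vabs x) = (x != 0).
Proof. by rewrite lt_neqAle vn_ge0 andbT eq_sym vn_eq0. Qed.

Lemma vnV x : vabs (x^-1) = (vabs x)^-1.
Proof.
have [->|x0] := eqVneq x 0; first by rewrite invr0 vn0 invr0.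
have nx0 : vabs x != 0 by rewrite vn_eq0.
by apply: (mulfI nx0); rewrite -vnM !divff// vn1.
Qed.

Lemma vnD_le x y B : vabs x <= B -> vabs y <= B -> vabs (x + y) <= B.
Proof. by move=> xB yB; apply: le_trans (vabsD_max _ _) _; rewrite ge_max xB. Qed.

Lemma vnB_le x y B : vabs x <= B -> vabs y <= B -> vabs (x - y) <= B.
Proof. by move=> xB yB; apply: vnD_le; rewrite ?vnN. Qed.

Lemma vn_sum_le (I : Type) (r : seq I) (P : pred I) (F : I -> K) (B : R) :
  0 <= B -> (forall i, P i -> vabs (F i) <= B) -> vabs (\sum_(i <- r | P i) F i) <= B.
Proof.
move=> B0 FB; elim/big_ind : _ => //; first by rewrite vn0.
by move=> x y; exact: vnD_le.
Qed.

Lemma vn_nat_le1 n : vabs (n%:R : K) <= 1.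
Proof.
by elim: n => [|n ih]; rewrite ?vn0 ?ler01// -natr1 vnD_le// vn1.
Qed.

Lemma vn_int_le1 (n : int) : vabs (n%:~R : K) <= 1.
Proof. by case: n => n; rewrite ?NegzE ?mulrNz ?vnN vn_nat_le1. Qed.

Lemma vn_prod (I : Type) (r : seq I) (P : pred I) (F : I -> K) :
  vabs (\prod_(i <- r | P i) F i) = \prod_(i <- r | P i) vabs (F i).
Proof. by apply: (big_morph _ vnM vn1). Qed.

Lemma vnK_le x y B : vabs (x - y) <= B -> vabs y <= B -> vabs x <= B.
Proof. by move=> ? ?; rewrite -[x](subrK y) vnD_le. Qed.

Lemma ballK x (e : R) y : ball x e y = (vabs (x - y) < e) :> Prop.
Proof. by rewrite ballEmdist. Qed.

End vabs_theory.

Section geometric.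
Context (R : realType).

Lemma geo_lt (C s e : R) : 0 <= C -> 0 < s < 1 -> 0 < e ->
  exists M, forall m, (M <= m)%N -> C * s ^+ m < e.
Proof.
move=> C0 /andP[s0 s1] e0.
have sl : `|s| < 1 by rewrite ger0_norm// ltW.
have := cvg_geometric C sl.
move=> /cvgrPdist_lt/(_ _ e0)[M _ HM].
exists M => m Mm; have := HM m Mm; rewrite /= sub0r normrN ger0_norm//.
by rewrite mulr_ge0// exprn_ge0// ltW.
Qed.

Lemma linear_le_geo (r : R) : 0 < r < 1 -> exists C s,
  [/\ 0 <= C, 0 < s < 1 & forall i : nat, (i.+1)%:R * r ^+ i <= C * s ^+ i].
Proof.
(* s is halfway between r and 1; Bernoulli's inequality for (s / r)^i = (1 + x)^i absorbs the factor
   i + 1. *)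
move=> /andP[r0 r1]; pose s := (1 + r) / 2; pose x := s / r - 1.
have s0 : 0 < s by rewrite divr_gt0// addr_gt0.
have x0 : 0 < x by rewrite subr_gt0 ltr_pdivlMr// mul1r /s; lra.
have bern i : 1 + i%:R * x <= (1 + x) ^+ i.
  elim: i => [|i ih]; first by rewrite mul0r addr0 expr0.
  rewrite exprS -natr1; have i0 : 0 <= i%:R :> R by [].
  apply: le_trans (ler_wpM2l _ ih); last by rewrite addr_ge0// ltW.
  by rewrite -subr_ge0 (_ : _ - _ = i%:R * x * x); [rewrite !mulr_ge0// ltW|ring].
exists (1 + x^-1), s; split.
- by rewrite addr_ge0// invr_ge0 ltW.
- by rewrite s0 /s; lra.
move=> i; have -> : s = (1 + x) * r by rewrite /x addrC subrK divfK// gt_eqF.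
rewrite exprMn mulrA ler_wpM2r ?exprn_ge0 ?(ltW r0)//.
apply: le_trans (ler_wpM2l _ (bern i)); last by rewrite addr_ge0// invr_ge0 ltW.
have -> : (1 + x^-1) * (1 + i%:R * x) = 1 + i%:R * x + x^-1 + i%:R.
  by field; rewrite gt_eqF.
rewrite -natr1.
have := mulr_ge0 (ler0n R i) (ltW x0).
have : 0 <= x^-1 by rewrite invr_ge0 ltW.
lra.
Qed.

End geometric.

Section geo_sum.
Context (R : realType) (p : nat) (K : padicComplex R p).
Implicit Types u : nat -> K.

(* A rate of convergence turns limits, in particular exchanges of summations,
   into estimates of finite sums. *)
Definition geo_sum u (S : K) := exists C s : R, [/\ 0 <= C, 0 < s < 1 &
  forall M, vabs (S - \sum_(i < M) u i) <= C * s ^+ M].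

Lemma geo_sum_sumn_inf u S : geo_sum u S -> sumn_inf u = S.
Proof.
move=> [C [s [C0 s01 H]]]; apply: cvg_lim; first exact: metric_hausdorff.
apply/cvg_ballP => e e0; have [M HM] := geo_lt C0 s01 e0.
exists M => // m /= Mm; rewrite ballK.
by apply: le_lt_trans (HM m Mm); rewrite /series/= big_mkord H.
Qed.

Lemma geo_sum_uniq u S S' : geo_sum u S -> geo_sum u S' -> S = S'.
Proof. by move=> /geo_sum_sumn_inf <- /geo_sum_sumn_inf. Qed.

(** In an ultrametric norm a tail is at most its largest term, so the bound on the terms is itself
    the rate, with the same C and s. *)
Lemma geo_sum_cvg u (C s : R) : 0 <= C -> 0 < s < 1 ->
  (forall i, vabs (u i) <= C * s ^+ i) ->
  forall M, vabs (sumn_inf u - \sum_(i < M) u i) <= C * s ^+ M.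
Proof.
move=> C0 s01 uC; have /andP[s0 s1] := s01.
have tail m n : (m <= n)%N ->
    vabs (\sum_(i < n) u i - \sum_(i < m) u i) <= C * s ^+ m.
  move=> mn; rewrite -!(big_mkord xpredT u) (big_cat_nat (leq0n m) mn)/= addrAC subrr add0r.
  rewrite big_seq; apply: vn_sum_le; first by rewrite mulr_ge0// exprn_ge0 ?ltW.
  move=> i; rewrite mem_index_iota => /andP[mi _]; apply: le_trans (uC i) _.
  by rewrite ler_wpM2l// ler_wiXn2l// ltW.
have /Cp_complete cS : cauchy (series u @ \oo).
  apply/cauchy_ballP => e e0; have [M HM] := geo_lt C0 s01 e0.
  exists ([set series u n | n in [set n | (M <= n)%N]],
          [set series u n | n in [set n | (M <= n)%N]]) => /=.
    by split; exists M => // n /= Mn; exists n.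
  move=> [x y] /= [[m Mm <-] [n Mn <-]]; rewrite ballK /series/= !big_mkord.
  by have [mn|/ltnW mn] := leqP m n; [rewrite vnB|];
    apply: le_lt_trans (tail _ _ mn) _; exact: HM.
move=> M; rewrite leNgt; apply/negP => lt.
have e0 : 0 < C * s ^+ M + 1 by rewrite ltr_wpDl// mulr_ge0// exprn_ge0 ?ltW.
have e1 : 0 < vabs (sumn_inf u - \sum_(i < M) u i).
  by apply: le_lt_trans lt; rewrite mulr_ge0// exprn_ge0 ?ltW.
have /cvg_ballP/(_ _ e1)[n _ Hn] := cS _.
have := Hn (maxn M n) (leq_maxr _ _).
rewrite /= ballK /series/= big_mkord => Hlt.
have := tail M (maxn M n) (leq_maxl _ _) => tl.
suff : vabs (sumn_inf u - \sum_(i < M) u i) < vabs (sumn_inf u - \sum_(i < M) u i).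
  by rewrite ltxx.
rewrite -[X in vabs X < _](subrKA (\sum_(i < maxn M n) u i)).
apply: le_lt_trans (vabsD_max _ _) _; rewrite gt_max.
by apply/andP; split => //; exact: le_lt_trans lt.
Qed.

Lemma geo_sum_ex u (C s : R) : 0 <= C -> 0 < s < 1 ->
  (forall i, vabs (u i) <= C * s ^+ i) -> geo_sum u (sumn_inf u).
Proof. by move=> C0 s01 uC; exists C, s; split => //; exact: geo_sum_cvg. Qed.

Lemma geo_sumD u u' S S' : geo_sum u S -> geo_sum u' S' ->
  geo_sum (fun i => u i + u' i) (S + S').
Proof.
move=> [C [s [C0 /andP[s0 s1] H]]] [C' [s' [C'0 /andP[s'0 s'1] H']]].
have max0 : 0 < Num.max s s' by rewrite lt_max s0.
exists (Num.max C C'), (Num.max s s'); split.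
- by rewrite le_max C0.
- by rewrite max0/= gt_max s1.
move=> M; rewrite big_split opprD addrACA; apply: vnD_le.
  apply: le_trans (H M) _; apply: ler_pM; rewrite ?exprn_ge0 ?(ltW s0) ?le_max ?lexx//.
  by rewrite lerXn2r ?nnegrE ?(ltW s0) ?(ltW max0)// le_max lexx.
apply: le_trans (H' M) _; apply: ler_pM; rewrite ?exprn_ge0 ?(ltW s'0) ?le_max ?lexx ?orbT//.
by rewrite lerXn2r ?nnegrE ?(ltW s'0) ?(ltW max0)// le_max lexx orbT.
Qed.

Lemma geo_sumZ (c : K) u S : geo_sum u S -> geo_sum (fun i => c * u i) (c * S).
Proof.
move=> [C [s [C0 s01 H]]]; exists (vabs c * C), s; split => //.
  by rewrite mulr_ge0// vn_ge0.
by move=> M; rewrite -mulr_sumr -mulrBr vnM -mulrA ler_wpM2l// vn_ge0.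
Qed.

(** In each block of m indices starting at a multiple of m only the first contributes, and s^(m M)
    <= s^M keeps the rate. *)
Lemma geo_sum_sparse u S m : (0 < m)%N ->
  (forall i, ~~ (m %| i)%N -> u i = 0) -> geo_sum u S ->
  geo_sum (fun j => u (m * j)%N) S.
Proof.
move=> m0 um [C [s [C0 s01 H]]]; exists C, s; split => // M.
have /andP[s0 s1] := s01.
apply: (@le_trans _ _ (C * s ^+ (m * M))); last first.
  by rewrite ler_wpM2l// ler_wiXn2l// ?ltW// leq_pmull.
rewrite (_ : \sum_(j < M) _ = \sum_(i < m * M) u i)//.
elim: M => [|M ih]; first by rewrite muln0 !big_ord0.
rewrite big_ord_recr/= ih mulnSr big_split_ord/=; congr (_ + _).
case: m m0 um {H ih} => // m _ um; rewrite big_ord_recl/= addn0 big1 ?addr0// => j _.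
rewrite um// dvdn_addr ?dvdn_mulr// gtnNdvd//.
by rewrite /bump add1n ltnS.
Qed.

End geo_sum.

(** * Multiplication of bilateral sequences by power series *)

Lemma exp_root (R : realType) (r : R) (m : nat) : (0 < m)%N -> 0 < r < 1 ->
  exists s : R, 0 < s < 1 /\ s ^+ m = r.
Proof.
move=> m0 /andP[r0 r1]; exists (powR r (m%:R^-1)).
have E : powR r (m%:R^-1) ^+ m = r.
  by rewrite -powR_mulrn ?powR_ge0// -powRrM mulVf ?pnatr_eq0 -?lt0n// powRr1// ltW.
have s0 : 0 < powR r (m%:R^-1) by rewrite powR_gt0.
split => //; rewrite s0/= ltNge; apply/negP => s1.
by have := exprn_ege1 m s1; rewrite E leNgt r1.
Qed.

Lemma absz_sub_succ_le (l : int) (i k : nat) :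
  (`|(l - i%:Z - k%:Z)%R|.+1 <= `|l|.+1 * (i.+1 * k.+1))%N.
Proof.
have : (`|(l - i%:Z - k%:Z)%R| <= `|l| + i + k)%N by lia.
move=> h; apply: (@leq_trans (`|l| + i + k).+1) => //; move: `|l|%N => n; nia.
Qed.

Lemma subz_ord_sub (l : int) n (i : 'I_n.+1) :
  l - i%:Z - (n - i)%N%:Z = l - n%:Z.
Proof. by have := ltn_ord i; lia. Qed.

Section convolution.
Context (R : realType) (p : nat) (K : padicComplex R p).
Implicit Types (b c : fps K) (q : int -> K).

(** Convergence on a disc of radius larger than 1. *)
Definition overconvergent (b : nat -> K) := exists C r : R,
  [/\ 0 <= C, 0 < r < 1 & forall i, vabs (b i) <= C * r ^+ i].

Definition linear_growth q := exists2 D : R, 0 <= D &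
  forall m, vabs (q m) <= D * (`|m|%N.+1)%:R.

(* The product of b(t) and the bilateral series with coefficients q. *)
Definition lconv (b : nat -> K) q (l : int) : K :=
  sumn_inf (fun i => b i * q (l - i%:Z)).

Lemma overconvergentM b c : overconvergent b -> overconvergent c -> overconvergent (b * c).
Proof.
move=> [C [r [C0 /andP[r0 r1] H]]] [C' [r' [C'0 /andP[r'0 r'1] H']]].
exists (C * C'), (Num.max r r'); split.
- exact: mulr_ge0.
- by rewrite lt_max r0/= gt_max r1.
have m0 : 0 < Num.max r r' by rewrite lt_max r0.
move=> i; rewrite fpsM; apply: vn_sum_le.
  by rewrite !mulr_ge0// exprn_ge0// ltW.
move=> j _; rewrite vnM.
have -> : Num.max r r' ^+ i = Num.max r r' ^+ j * Num.max r r' ^+ (i - j).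
  by rewrite -exprD subnKC// -ltnS.
rewrite mulrACA.
apply: ler_pM; rewrite ?vn_ge0//.
  apply: le_trans (H _) _; rewrite ler_wpM2l// lerXn2r ?nnegrE ?(ltW r0) ?(ltW m0)//.
  by rewrite le_max lexx.
apply: le_trans (H' _) _; rewrite ler_wpM2l// lerXn2r ?nnegrE ?(ltW r'0) ?(ltW m0)//.
by rewrite le_max lexx orbT.
Qed.

Lemma overconvergent_subst m b : (0 < m)%N -> overconvergent b ->
  overconvergent (ps_subst_pow m b).
Proof.
move=> m0 [C [r [C0 r01 H]]]; have [s [s01 sm]] := exp_root m0 r01.
have /andP[s0 s1] := s01.
exists C, s; split => // i; rewrite /ps_subst_pow; case: ifP => [mi|_].
  by apply: le_trans (H _) _; rewrite -sm -exprM mulnC divnK.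
by rewrite vn0 mulr_ge0// exprn_ge0// ltW.
Qed.

(** The factors i + 1 and k + 1 produced by the linear growth of q are absorbed by enlarging the
    geometric rates; one rate for both indices serves the summation over i + k = n. *)
Lemma double_term_bound b c q : overconvergent b -> overconvergent c ->
  linear_growth q -> exists C s : R, [/\ 0 <= C, 0 < s < 1 &
    forall l (i k : nat), vabs (b i * c k * q (l - i%:Z - k%:Z)) <=
      C * (`|l|%N.+1)%:R * s ^+ (i + k)].
Proof.
move=> [C [r [C0 r01 H]]] [C' [r' [C'0 r'01 H']]] [D D0 HD].
have [A [s [A0 /andP[s0 s1] As]]] := linear_le_geo r01.
have [A' [s' [A'0 /andP[s'0 s'1] As']]] := linear_le_geo r'01.
have m0 : 0 < Num.max s s' by rewrite lt_max s0.
exists (C * C' * D * A * A'), (Num.max s s'); split.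
- by rewrite !mulr_ge0.
- by rewrite m0/= gt_max s1.
move=> l i k; have /andP[r0 _] := r01; have /andP[r'0 _] := r'01.
apply: (@le_trans _ _ (C * r ^+ i * (C' * r' ^+ k) *
    (D * (`|l|%N.+1)%:R * (i.+1)%:R * (k.+1)%:R))).
  rewrite !vnM; apply: ler_pM; rewrite ?mulr_ge0 ?vn_ge0//.
    by apply: ler_pM; rewrite ?vn_ge0.
  apply: le_trans (HD _) _; rewrite -!mulrA ler_wpM2l// -!natrM ler_nat.
  exact: absz_sub_succ_le.
have -> : C * r ^+ i * (C' * r' ^+ k) *
    (D * (`|l|%N.+1)%:R * (i.+1)%:R * (k.+1)%:R) =
  C * C' * D * (`|l|%N.+1)%:R * ((i.+1)%:R * r ^+ i * ((k.+1)%:R * r' ^+ k)) by ring.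
have -> : C * C' * D * A * A' * (`|l|%N.+1)%:R * Num.max s s' ^+ (i + k) =
  C * C' * D * (`|l|%N.+1)%:R * (A * Num.max s s' ^+ i * (A' * Num.max s s' ^+ k)).
  by rewrite exprD; ring.
rewrite ler_wpM2l ?mulr_ge0//; apply: ler_pM.
- by rewrite mulr_ge0// exprn_ge0// ltW.
- by rewrite mulr_ge0// exprn_ge0// ltW.
- apply: le_trans (As i) _; rewrite ler_wpM2l// lerXn2r ?nnegrE ?(ltW s0) ?(ltW m0)//.
  by rewrite le_max lexx.
- apply: le_trans (As' k) _; rewrite ler_wpM2l// lerXn2r ?nnegrE ?(ltW s'0) ?(ltW m0)//.
  by rewrite le_max lexx orbT.
Qed.

Lemma overconvergent1 : overconvergent (1 : fps K).
Proof.
exists 1, 2^-1; split => //; first by apply/andP; split; lra.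
by case=> [|i]; rewrite fps1 ?vn1 ?mulr1// vn0 mul1r exprn_ge0// invr_ge0.
Qed.

Lemma term_bound b q : overconvergent b -> linear_growth q -> exists C s : R,
  [/\ 0 <= C, 0 < s < 1 & forall l (i : nat), vabs (b i * q (l - i%:Z)) <=
      C * (`|l|%N.+1)%:R * s ^+ i].
Proof.
move=> bo ql; have [C [s [C0 s01 H]]] := double_term_bound bo overconvergent1 ql.
exists C, s; split => // l i; have := H l i 0%N.
by rewrite fps1 mulr1 subr0 addn0.
Qed.

Lemma lconv_sum b q l : overconvergent b -> linear_growth q ->
  geo_sum (fun i => b i * q (l - i%:Z)) (lconv b q l).
Proof.
move=> bo ql; have [C [s [C0 s01 H]]] := term_bound bo ql.
by apply: (geo_sum_ex _ s01 (H l)); rewrite mulr_ge0.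
Qed.

Lemma linear_growth_lconv b q : overconvergent b -> linear_growth q ->
  linear_growth (lconv b q).
Proof.
move=> bo ql; have [C [s [C0 s01 H]]] := term_bound bo ql.
exists C => // m; have C0' : 0 <= C * (`|m|%N.+1)%:R by rewrite mulr_ge0.
by have := geo_sum_cvg C0' s01 (H m) 0%N; rewrite big_ord0 subr0 expr0 mulr1.
Qed.

Lemma sum_triangle (w : nat -> nat -> K) M :
  \sum_(n < M) \sum_(i < n.+1) w i (n - i)%N = \sum_(i < M) \sum_(k < M - i) w i k.
Proof.
elim: M => [|M ih]; first by rewrite !big_ord0.
rewrite big_ord_recr/= ih [RHS]big_ord_recr/= subSnn big_ord1.
rewrite [X in _ + X]big_ord_recr/= subnn addrA; congr (_ + _).
rewrite -big_split/=; apply: eq_bigr => i _.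
by rewrite (subSn (ltnW (ltn_ord i))) big_ord_recr.
Qed.

(** Fubini with rates: over the triangle i + k < M both iterated sums have the same partial sum, and
    each remainder is at most B s^M. *)
Lemma lconvA b c q : overconvergent b -> overconvergent c -> linear_growth q ->
  lconv b (lconv c q) = lconv (b * c) q.
Proof.
move=> bo co ql; apply/funext => l.
have [C [s [C0 s01 H]]] := double_term_bound bo co ql.
have /andP[s0 s1] := s01.
pose w (i k : nat) := b i * c k * q (l - i%:Z - k%:Z).
pose B := C * (`|l|%N.+1)%:R.
have B0 : 0 <= B by rewrite mulr_ge0.
apply: geo_sum_sumn_inf; exists B, s; split => // M.
have -> : lconv (b * c) q l - \sum_(i < M) b i * lconv c q (l - i%:Z) =
    (lconv (b * c) q l - \sum_(n < M) (b * c) n * q (l - n%:Z)) -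
    \sum_(i < M) (b i * lconv c q (l - i%:Z) - \sum_(k < M - i) w i k).
  rewrite sumrB -sum_triangle opprB addrA; congr (_ - _).
  rewrite -addrA [X in _ + X](_ : _ = 0) ?addr0//; apply/eqP.
  rewrite addrC subr_eq0; apply/eqP; apply: eq_bigr => n _.
  rewrite fpsM mulr_suml; apply: eq_bigr => i _; rewrite /w; congr (_ * q _).
  by rewrite subz_ord_sub.
apply: vnB_le.
  apply: geo_sum_cvg => // n; rewrite fpsM mulr_suml; apply: vn_sum_le.
    by rewrite mulr_ge0// exprn_ge0// ltW.
  move=> i _; have := H l i (n - i)%N.
  by rewrite subz_ord_sub subnKC// -ltnS.
apply: vn_sum_le; first by rewrite mulr_ge0// exprn_ge0// ltW.
move=> i _; have wS : geo_sum (w i) (b i * lconv c q (l - i%:Z)).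
  have := geo_sumZ (b i) (lconv_sum (l - i%:Z) co ql).
  by rewrite /w; under eq_fun do rewrite mulrA.
(* The inner remainder starts at k = M - i, so its rate s^(M - i) times the factor s^i of the terms
   is again s^M. *)
rewrite -(geo_sum_sumn_inf wS).
have := @geo_sum_cvg _ _ _ (w i) (B * s ^+ i) s _ s01 _ (M - i)%N.
rewrite -mulrA -exprD subnKC ?(ltnW (ltn_ord i))//; apply.
  by rewrite mulr_ge0// exprn_ge0// ltW.
by move=> k; apply: le_trans (H l i k) _; rewrite exprD mulrA.
Qed.

Lemma geo_sum_finite (u : nat -> K) n : (forall i, (n <= i)%N -> u i = 0) ->
  geo_sum u (\sum_(i < n) u i).
Proof.
move=> un; pose B := \sum_(i < n) vabs (u i).
have uB i : vabs (u i) <= B.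
  have [/un ->|lt] := leqP n i; first by rewrite vn0 sumr_ge0// => j _; exact: vn_ge0.
  rewrite /B (bigD1 (Ordinal lt))//= lerDl sumr_ge0// => j _; exact: vn_ge0.
have B0 : 0 <= B by apply: le_trans (uB 0%N); exact: vn_ge0.
(* The factor 2^n compensates 2^-M for M < n; from M = n on the remainder is 0. *)
exists (B * 2 ^+ n), 2^-1; split; first by rewrite mulr_ge0// exprn_ge0.
  by apply/andP; split; lra.
move=> M; have [nM|Mn] := leqP n M.
  rewrite -!(big_mkord xpredT u) (big_cat_nat (leq0n n) nM)/= opprD addrA subrr sub0r.
  rewrite big_seq big1 ?oppr0 ?vn0 ?mulr_ge0 ?exprn_ge0// ?invr_ge0//.
  by move=> i; rewrite mem_index_iota => /andP[/un].
rewrite -mulrA -[n in 2 ^+ n](subnK (ltnW Mn)) exprD -mulrA -exprMn divff// expr1n mulr1.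
apply: (@le_trans _ _ B); last by rewrite ler_peMr// exprn_ege1//; lra.
by apply: vnB_le; apply: vn_sum_le.
Qed.

Lemma lconv_monomial (x : K) m q l : lconv (ps_monomial x m) q l = x * q (l - m%:Z).
Proof.
apply: geo_sum_sumn_inf.
have := @geo_sum_finite (fun i => ps_monomial x m i * q (l - i%:Z)) m.+1.
rewrite big_ord_recr/= big1 => [|i _]; last by rewrite /ps_monomial ltn_eqF ?mul0r.
have pm : ps_monomial x m m = x by rewrite /ps_monomial eqxx.
rewrite add0r pm; apply => i mi.
by rewrite /ps_monomial gtn_eqF// mul0r.
Qed.

(** The product at l reads q only up to l, so an identity valid on a half-line of indices is
    enough. *)
Lemma lconv_ext b q q' (l : int) :
  (forall m : int, (m <= l)%R -> q m = q' m) -> lconv b q l = lconv b q' l.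
Proof.
move=> qq'; rewrite /lconv; congr (sumn_inf _); apply/funext => i.
by rewrite qq'//; lia.
Qed.

Lemma lconvZ b q (x : K) l : overconvergent b -> linear_growth q ->
  lconv b (fun m => x * q m) l = x * lconv b q l.
Proof.
move=> bo ql; apply: geo_sum_sumn_inf.
by have := geo_sumZ x (lconv_sum l bo ql); under eq_fun do rewrite mulrCA.
Qed.

Lemma lconv_shift b q m l : lconv b (fun n => q (n - m)) l = lconv b q (l - m).
Proof. by rewrite /lconv; congr (sumn_inf _); apply/funext => i; rewrite addrAC. Qed.

Lemma overconvergentD b c : overconvergent b -> overconvergent c -> overconvergent (b + c).
Proof.
move=> [C [r [C0 /andP[r0 r1] H]]] [C' [r' [C'0 /andP[r'0 r'1] H']]].
have m0 : 0 < Num.max r r' by rewrite lt_max r0.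
exists (Num.max C C'), (Num.max r r'); split.
- by rewrite le_max C0.
- by rewrite m0/= gt_max r1.
move=> i; apply: vnD_le.
  apply: le_trans (H i) _; apply: ler_pM; rewrite ?exprn_ge0 ?(ltW r0) ?le_max ?lexx//.
  by rewrite lerXn2r ?nnegrE ?(ltW r0) ?(ltW m0)// le_max lexx.
apply: le_trans (H' i) _; apply: ler_pM; rewrite ?exprn_ge0 ?(ltW r'0) ?le_max ?lexx ?orbT//.
by rewrite lerXn2r ?nnegrE ?(ltW r'0) ?(ltW m0)// le_max lexx orbT.
Qed.

Lemma overconvergent_monomial (x : K) m : overconvergent (ps_monomial x m).
Proof.
exists (vabs x * 2 ^+ m), 2^-1; split.
- by rewrite mulr_ge0 ?vn_ge0// exprn_ge0.
- by apply/andP; split; lra.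
move=> i; rewrite /ps_monomial; case: eqP => [->|_].
  by rewrite mulr1n -mulrA -exprMn divff// expr1n mulr1.
by rewrite mulr0n vn0 !mulr_ge0 ?vn_ge0 ?exprn_ge0// invr_ge0.
Qed.

Lemma overconvergentN (f : fps K) : overconvergent f -> overconvergent (- f).
Proof. by move=> [C [r [C0 r01 H]]]; exists C, r; split => // i; rewrite fpsN vnN. Qed.

Lemma lconvD (f h : fps K) u l : overconvergent f -> overconvergent h -> linear_growth u ->
  lconv (f + h) u l = lconv f u l + lconv h u l.
Proof.
move=> fo ho ul; apply: geo_sum_sumn_inf.
have := geo_sumD (lconv_sum l fo ul) (lconv_sum l ho ul).
by congr geo_sum; apply/funext => i; rewrite fpsD mulrDl.
Qed.

Lemma lconvN (f : fps K) u l : overconvergent f -> linear_growth u ->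
  lconv (- f) u l = - lconv f u l.
Proof.
move=> fo ul; apply: geo_sum_sumn_inf; rewrite -[X in geo_sum _ X]mulN1r.
have := geo_sumZ (-1) (lconv_sum l fo ul).
by congr geo_sum; apply/funext => i; rewrite fpsN mulN1r mulNr.
Qed.

Lemma linear_growth_scaled_shift (x : K) (u : int -> K) (m : nat) : linear_growth u ->
  linear_growth (fun n => x * u (n - m%:Z)).
Proof.
move=> [D D0 H]; exists (vabs x * D * m.+1%:R) => [|n].
  by rewrite !mulr_ge0// vn_ge0.
rewrite vnM -!mulrA ler_wpM2l ?vn_ge0//; apply: le_trans (H _) _.
rewrite ler_wpM2l// -natrM ler_nat.
by have := absz_sub_succ_le n m 0; rewrite subr0 mulnC muln1.
Qed.

(* The substitution of t^p for t in bilateral series. *)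
Definition frob q (n : int) : K := if (p%:Z %| n)%Z then q (n %/ p%:Z)%Z else 0.

Hypothesis p0 : (0 < p)%N.

Lemma frob_mul q m : frob q (p%:Z * m) = q m.
Proof. by rewrite /frob dvdz_mulr// mulKz//; case: p p0. Qed.

Lemma linear_growth_frob q : linear_growth q -> linear_growth (frob q).
Proof.
move=> [D D0 H]; exists D => // n; rewrite /frob; case: ifP => [/dvdzP[k ->]|_].
  rewrite mulzK; last by case: p p0.
  apply: le_trans (H k) _; rewrite ler_wpM2l// ler_nat ltnS abszM.
  by rewrite leq_pmulr.
by rewrite vn0 mulr_ge0.
Qed.

Lemma lconv_frob c q m : overconvergent c -> linear_growth q ->
  geo_sum (fun i => c (p * i)%N * q (m - i%:Z)) (lconv c (frob q) (p%:Z * m)).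
Proof.
move=> co ql; have := lconv_sum (p%:Z * m) co (linear_growth_frob ql).
move=> /(geo_sum_sparse p0) H; have := H _.
under eq_fun => j.
  have -> : p%:Z * m - (p * j)%N%:Z = p%:Z * (m - j%:Z) by rewrite PoszM; ring.
  rewrite frob_mul; over.
apply=> i pi; rewrite /frob ifF ?mulr0//; apply/negP => /dvdzP[k E].
move/negP: pi; apply; have : (p%:Z %| i%:Z)%Z; last by [].
by apply/dvdzP; exists (m - k); rewrite mulrBl -E; ring.
Qed.

Lemma lconv_subst_frob b q : overconvergent b -> linear_growth q ->
  lconv (ps_subst_pow p b) (frob q) = frob (lconv b q).
Proof.
move=> bo ql; apply/funext => n; rewrite [RHS]/frob.
case: ifPn => [/dvdzP[k ->]|pn].
  rewrite mulzK; last by case: p p0.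
  rewrite mulrC; apply: geo_sum_uniq (lconv_frob k (overconvergent_subst p0 bo) ql) _.
  by under eq_fun do rewrite /ps_subst_pow dvdn_mulr// mulKn//; exact: lconv_sum.
(* Every term is 0 here: p | i and p | n - i would give p | n. *)
apply: geo_sum_sumn_inf; have := @geo_sum_finite (fun=> 0) 0; rewrite big_ord0.
rewrite [X in geo_sum X](_ : _ = fun i => ps_subst_pow p b i * frob q (n - i%:Z)); first by apply.
apply/funext => i; rewrite /ps_subst_pow /frob; case: ifPn => pi; last by rewrite mul0r.
rewrite ifF ?mulr0//; apply/negP => pni; move/negP: pn; apply.
rewrite -[n](subrK i%:Z); apply: rpredD => //.
Qed.

End convolution.

(** * Absolute values of factorials *)

Lemma fact_exp_le p m l : (0 < p)%N -> (0 < m)%N -> (m * p <= l)%N ->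
  (p.-1 * m + m.-1 <= l.-1)%N.
Proof. by case: p m => [//|p] [//|m] _ _ /=; nia. Qed.

Section padic_nat.
Context (R : realType) (p : nat) (K : padicComplex R p).
Hypothesis hp : prime p.

Let p0 : (0 < p)%N. Proof. exact: prime_gt0. Qed.

Lemma vnp : vabs (p%:R : K) = p%:R^-1. Proof. exact: Cp_vabsp. Qed.

Lemma vnp_lt1 : vabs (p%:R : K) < 1.
Proof. by rewrite vnp invf_lt1 ?ltr1n ?ltr0n// prime_gt1. Qed.

Lemma vn_nat_coprime n : coprime p n -> vabs (n%:R : K) = 1.
Proof.
move=> /(coprimeP _ p0)[[u v] /= uv].
apply/eqP; rewrite eq_le vn_nat_le1/= leNgt; apply/negP => n1.
have E : (u * p)%N%:R - (v * n)%N%:R = 1 :> K.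
  by rewrite -natrB ?uv// ltnW// -subn_gt0 uv.
have : vabs ((u * p)%N%:R - (v * n)%N%:R : K) < 1.
  apply: le_lt_trans (vabsD_max _ _) _; rewrite gt_max vnN !natrM !vnM.
  apply/andP; split.
    by apply: le_lt_trans vnp_lt1; rewrite ler_piMl ?vn_ge0 ?vn_nat_le1.
  by apply: le_lt_trans n1; rewrite ler_piMl ?vn_ge0 ?vn_nat_le1.
by rewrite E vn1 ltxx.
Qed.

Lemma vn_nat_lower n : (0 < n)%N -> n%:R^-1 <= vabs (n%:R : K).
Proof.
move=> n0; have [m cm nE] := pfactor_coprime hp n0.
rewrite {2}nE natrM natrX vnM vnX vn_nat_coprime// mul1r vnp exprVn lef_pV2 ?posrE.
- rewrite -natrX ler_nat {2}nE leq_pmull//.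
  by move: n0; rewrite nE muln_gt0 => /andP[].
- by rewrite ltr0n.
- by rewrite exprn_gt0// ltr0n.
Qed.

Lemma natr_eq0K n : (n%:R == 0 :> K) = (n == 0)%N.
Proof.
have [->|n0] := eqVneq n 0%N; first by rewrite eqxx.
apply/negbTE; rewrite -vn_gt0; apply: lt_le_trans (vn_nat_lower _); rewrite ?lt0n//.
by rewrite invr_gt0 ltr0n lt0n.
Qed.

Lemma intr_eq0K (n : int) : (n%:~R == 0 :> K) = (n == 0).
Proof.
by case: n => n; rewrite ?natr_eq0K// NegzE mulrNz oppr_eq0 oppr_eq0 [n.+1%:~R == 0]natr_eq0K.
Qed.

Lemma vn_int_lower (n : int) : n != 0 -> `|n|%N%:R^-1 <= vabs (n%:~R : K).
Proof.
case: n => n n0; first by rewrite vn_nat_lower// lt0n.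
by rewrite NegzE mulrNz vnN abszN vn_nat_lower.
Qed.

(** The factors of l! divisible by p are p, 2p, ..., (l %/ p) p; the others are units. *)
Lemma vn_fact l : vabs ((l`!)%:R : K) = p%:R^-1 ^+ (l %/ p) * vabs (((l %/ p)`!)%:R : K).
Proof.
elim: l => [|l ih]; first by rewrite div0n expr0 mul1r.
rewrite factS natrM vnM ih divnS//; have [pl|pl] := boolP (p %| l.+1)%N.
  rewrite add1n exprS factS natrM vnM.
  have -> : vabs (l.+1%:R : K) = p%:R^-1 * vabs ((l %/ p).+1%:R : K).
    rewrite -vnp -vnM -natrM; congr (vabs _%:R).
    by rewrite -[(l %/ p).+1]add1n -[1%N]/(true : nat) -pl -divnS// mulnC divnK.
  by ring.
by rewrite add0n vn_nat_coprime ?mul1r// prime_coprime.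
Qed.

Section varpi.
Context (o : R).
Hypotheses (o01 : 0 < o < 1) (op : o ^+ p.-1 = p%:R^-1).

Let o0 : 0 < o. Proof. by case/andP: o01. Qed.
Let o1 : o <= 1. Proof. by case/andP: o01 => _ /ltW. Qed.

(** Here [o] is p^(-1/(p-1)), later |pi0|. By Legendre's formula |l!| = o^(l - S) with S the sum of
    the base p digits of l, and S >= 1 for l > 0. *)
Lemma fact_lower l : (0 < l)%N -> o ^+ l.-1 <= vabs ((l`!)%:R : K).
Proof.
elim/ltn_ind: l => l ih l0; rewrite vn_fact.
have [lp|pl] := ltnP l p.
  by rewrite divn_small// vn1 expr0 mulr1 exprn_ile1// ltW.
have m0 : (0 < l %/ p)%N by rewrite divn_gt0.
apply: (@le_trans _ _ (p%:R^-1 ^+ (l %/ p) * o ^+ (l %/ p).-1)); last first.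
  by rewrite ler_wpM2l ?exprn_ge0 ?invr_ge0// ih// ltn_Pdiv// prime_gt1.
rewrite -op -exprM -exprD ler_wiXn2l ?(ltW o0)//.
exact: fact_exp_le p0 m0 (leq_trunc_div _ _).
Qed.

Lemma fact_lower_weak l : o ^+ l <= vabs ((l`!)%:R : K).
Proof.
case: l => [|l]; first by rewrite expr0 vn1.
apply: le_trans (fact_lower (ltn0Sn l)).
by rewrite exprS ler_piMl// exprn_ge0// ltW.
Qed.

(** In terms of the digit sum S, |l!| = o^(l - S), and for l > 0 o^(-S) <= p^(number of digits) <= p
    l. *)
Lemma fact_upper l : vabs ((l`!)%:R : K) <= p%:R * l.+1%:R * o ^+ l.
Proof.
suff H : (0 < l)%N -> vabs ((l`!)%:R : K) <= p%:R * l%:R * o ^+ l.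
  case: l H => [_|l /(_ (ltn0Sn l)) H].
    by rewrite vn1 expr0 !mulr1 ler1n.
  by apply: le_trans H _; rewrite ler_wpM2r ?exprn_ge0 ?(ltW o0)// ler_wpM2l// ler_nat.
have po1 r : (r < p)%N -> 1 <= p%:R * o ^+ r.
  move=> rp; rewrite -ler_pdivrMl ?ltr0n// mulr1 -op ler_wiXn2l ?(ltW o0)//.
  by rewrite -ltnS prednK.
elim/ltn_ind: l => l ih l0; rewrite vn_fact.
have [lp|pl] := ltnP l p.
  rewrite divn_small// vn1 expr0 mulr1; apply: le_trans (po1 _ lp) _.
  by rewrite ler_wpM2r ?exprn_ge0 ?(ltW o0)// ler_peMr// ler1n.
have m0 : (0 < l %/ p)%N by rewrite divn_gt0.
have := ih (l %/ p)%N (ltn_Pdiv (prime_gt1 hp) l0) m0 => H.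
apply: le_trans (ler_wpM2l _ H) _; first by rewrite exprn_ge0 ?invr_ge0.
apply: (@le_trans _ _ (o ^+ (p * (l %/ p)) * (p%:R * (l %/ p)%:R))).
  rewrite -op -exprM mulrCA [X in _ <= X]mulrC ler_wpM2l ?mulr_ge0// -exprD.
  by rewrite -mulSnr prednK.
have -> : o ^+ l = o ^+ (l %/ p * p) * o ^+ (l %% p) by rewrite -exprD -divn_eq.
have := po1 _ (ltn_pmod l p0); have := leq_trunc_div l p.
set m := (l %/ p)%N; set r := (l %% p)%N => ml pr.
apply: (@le_trans _ _ (p%:R * (m * p)%N%:R * (o ^+ (m * p) * o ^+ r))); last first.
  by rewrite ler_wpM2r ?mulr_ge0 ?exprn_ge0 ?(ltW o0)// ler_wpM2l// ler_nat.
rewrite natrM mulnC.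
have -> : p%:R * (m%:R * p%:R) * (o ^+ (m * p) * o ^+ r) =
  o ^+ (m * p) * (p%:R * m%:R) * (p%:R * o ^+ r) by ring.
by rewrite ler_peMr// !mulr_ge0// exprn_ge0// ltW.
Qed.

Lemma fpsX_bound (c r : R) (f : fps K) k i : 0 <= c -> 0 <= r ->
  (forall i, vabs (f i) <= c * r ^+ i) -> vabs ((f ^+ k) i) <= c ^+ k * r ^+ i.
Proof.
move=> c0 r0 H; elim: k i => [|k ih] i.
  rewrite !expr0 fps1; case: i => [|i]; rewrite ?vn1 ?mulr1// vn0 mul1r exprn_ge0//.
rewrite exprS fpsM; apply: vn_sum_le => [|j _]; first by rewrite mulr_ge0// exprn_ge0.
have -> : r ^+ i = r ^+ j * r ^+ (i - j) by rewrite -exprD subnKC// -ltnS.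
by rewrite vnM exprS mulrACA ler_pM ?vn_ge0.
Qed.

(** The powers of o in the bound for f^k cancel the denominators k!, since o^k <= |k!|. *)
Lemma exp_bound (r : R) (f : fps K) : 0 <= r -> f 0%N = 0 ->
  (forall i, vabs (f i) <= o * r ^+ i) -> forall i, vabs (fps_exp f i) <= r ^+ i.
Proof.
move=> r0 f0 H i; rewrite (fps_expE f0 (leqnn i)).
apply: vn_sum_le => [|k _]; first exact: exprn_ge0.
rewrite vnM vnV ler_pdivrMr; last by rewrite vn_gt0 natr_eq0K -lt0n fact_gt0.
apply: le_trans (fpsX_bound _ _ (ltW o0) r0 H) _; rewrite mulrC ler_wpM2l ?exprn_ge0//.
exact: fact_lower_weak.
Qed.

End varpi.
End padic_nat.

(** * The Artin-Hasse exponential *)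

Section lacunary.
Context (K : fieldType) (p : nat).
Hypothesis p1 : (1 < p)%N.
Implicit Types c : nat -> K.

Let p0 : (0 < p)%N. Proof. exact: ltnW. Qed.

(* \sum_i c_i t^(p^i) *)
Definition lac c : fps K := fun m => \sum_(i < m.+1 | (p ^ i == m)%N) c i.

Lemma lacE c i : lac c (p ^ i)%N = c i.
Proof.
rewrite /lac (big_pred1 (Ordinal (leqW (ltn_expl i p1) : (i < (p ^ i).+1)%N)))// => j.
by rewrite /= eqn_exp2l.
Qed.

Lemma lac_out c m : (forall i, (p ^ i)%N != m) -> lac c m = 0.
Proof. by move=> H; rewrite /lac big1// => i; rewrite (negbTE (H i)). Qed.

Lemma lac0 c : lac c 0%N = 0.
Proof. by apply: lac_out => i; rewrite -lt0n expn_gt0 p0. Qed.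

Lemma lac_cases m : (exists i, (p ^ i)%N = m) \/ (forall i, (p ^ i)%N != m).
Proof.
have [[i H]|H] := pselect (exists i, (p ^ i)%N = m); first by left; exists i.
by right=> i; apply/eqP => E; apply: H; exists i.
Qed.

Lemma lacD c c' : lac (fun i => c i + c' i) = lac c + lac c'.
Proof. by apply/funext => m; rewrite fpsD /lac big_split. Qed.

Lemma lacMn c n : lac c *+ n = lac (fun i => c i *+ n).
Proof. by apply/funext => m; rewrite fpsMn /lac sumrMnl. Qed.

Lemma eq_lac c c' : c =1 c' -> lac c = lac c'.
Proof. by move=> /funext ->. Qed.

Lemma lac_subst c :
  (ps_subst_pow p (lac c) : fps K) = lac (fun i => if i is j.+1 then c j else 0).
Proof.
apply/funext => m; rewrite /ps_subst_pow; case: (lac_cases m) => [[i <-]|H].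
  rewrite lacE; case: i => [|i]; first by rewrite expn0 dvdn1 gtn_eqF.
  by rewrite expnS dvdn_mulr// mulKn// lacE.
rewrite [RHS]lac_out//; case: ifP => // /dvdnP[k mE].
rewrite mE mulnK// lac_out// => i; apply/eqP => iE.
by move/eqP: (H i.+1); apply; rewrite expnSr iE.
Qed.

Lemma monomial_lac (x : K) :
  (ps_monomial x 1 : fps K) = lac (fun i => if i is j.+1 then 0 else x).
Proof.
apply/funext => m; rewrite /ps_monomial; case: (lac_cases m) => [[i <-]|H].
  rewrite lacE; case: i => [|i]; first by rewrite expn0.
  by rewrite gtn_eqF// -[1%N](expn0 p) ltn_exp2l.
by rewrite lac_out// eq_sym (negbTE (H 0%N)).
Qed.

Lemma ps_subst_pow_comp m n (f : fps K) : (0 < m)%N -> (0 < n)%N ->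
  ps_subst_pow m (ps_subst_pow n f) = ps_subst_pow (m * n) f.
Proof.
move=> m0 n0; apply/funext => i; rewrite /ps_subst_pow.
case: ifPn => [/dvdnP[k ->]|mi].
  by rewrite mulnK// [(k * m)%N]mulnC dvdn_pmul2l// divnMl.
by rewrite ifF//; apply/negbTE; apply: contra mi => /(dvdn_trans _); apply; rewrite dvdn_mulr.
Qed.

Lemma ps_subst_powD m (f g : fps K) :
  (ps_subst_pow m (f + g) : fps K) = (ps_subst_pow m f : fps K) + (ps_subst_pow m g : fps K).
Proof. by apply/funext => i; rewrite fpsD /ps_subst_pow; case: ifP; rewrite ?addr0. Qed.

Lemma ps_subst_powN m (f : fps K) :
  (ps_subst_pow m (- f) : fps K) = - (ps_subst_pow m f : fps K).
Proof. by apply/funext => i; rewrite fpsN /ps_subst_pow; case: ifP; rewrite ?oppr0. Qed.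

Lemma ps_subst_pow_monomial (x : K) m k : (0 < m)%N ->
  ps_subst_pow m (ps_monomial x k) = ps_monomial x (k * m).
Proof.
move=> m0; apply/funext => i; rewrite /ps_subst_pow /ps_monomial.
case: ifPn => [/dvdnP[j ->]|mi]; first by rewrite mulnK// eqn_pmul2r.
by rewrite (_ : i == _ = false)//; apply: contraNF mi => /eqP ->; rewrite dvdn_mull.
Qed.

Lemma ps_subst_pow0 m (f : fps K) : ps_subst_pow m f 0%N = f 0%N.
Proof. by rewrite /ps_subst_pow dvdn0 div0n. Qed.

End lacunary.

Section frobenius.
Context (A : comNzRingType) (p : nat).

Lemma exprD_prime (x y : A) : prime p ->
  (x + y) ^+ p = x ^+ p + y ^+ p +
    (\sum_(i < p.-1) x ^+ (p.-1 - i) * y ^+ i.+1 *+ ('C(p, i.+1) %/ p)) *+ p.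
Proof.
move=> pp; rewrite exprDn; case: p pp => // q qp.
rewrite big_ord_recl/= subn0 expr0 mulr1 bin0 mulr1n -addrA; congr (_ + _).
rewrite big_ord_recr/= /bump/= add1n subnn expr0 mul1r binn mulr1n addrC; congr (_ + _).
rewrite -sumrMnl; apply: eq_bigr => i _; rewrite /bump/= add1n subSS -mulrnA divnK//.
by apply: prime_dvd_bin => //=; rewrite ltnS.
Qed.

End frobenius.

Section dwork_lemma.
Context (R : realType) (p : nat) (K : padicComplex R p).
Hypothesis hp : prime p.
Context (o : R).
Hypotheses (o01 : 0 < o < 1) (op : o ^+ p.-1 = p%:R^-1).
Implicit Types f g : fps K.

Let p0 : (0 < p)%N. Proof. exact: prime_gt0. Qed.
Let p1 : (1 < p)%N. Proof. exact: prime_gt1. Qed.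
Let natr_eq0K := natr_eq0K K hp.
Let vp := vabs (p%:R : K).

Lemma vn_M_le1 (x y : K) : vabs x <= 1 -> vabs y <= 1 -> vabs (x * y) <= 1.
Proof. by move=> x1 y1; rewrite vnM mulr_ile1 ?vn_ge0. Qed.

Lemma fps_M_le1 f g : (forall i, vabs (f i) <= 1) -> (forall i, vabs (g i) <= 1) ->
  forall i, vabs ((f * g) i) <= 1.
Proof.
by move=> f1 g1 i; rewrite fpsM; apply: vn_sum_le => // j _; apply: vn_M_le1.
Qed.

Lemma fps_X_le1 f n : (forall i, vabs (f i) <= 1) -> forall i, vabs ((f ^+ n) i) <= 1.
Proof.
move=> f1; elim: n => [|n ih] i; last by rewrite exprS; apply: fps_M_le1.
by rewrite expr0 fps1; case: i => [|i]; rewrite ?vn1// vn0.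
Qed.

Lemma fps_frob_add f g : (forall i, vabs (f i) <= 1) -> (forall i, vabs (g i) <= 1) ->
  forall i, vabs (((f + g) ^+ p - (f ^+ p + g ^+ p)) i) <= vp.
Proof.
move=> f1 g1 i; rewrite exprD_prime// addrC addKr fpsMn -mulr_natr vnM.
rewrite ler_piMl ?vn_ge0// fps_sum; apply: vn_sum_le => // j _.
rewrite fpsMn -mulr_natr; apply: vn_M_le1; last exact: vn_nat_le1.
by apply: fps_M_le1; apply: fps_X_le1.
Qed.

Lemma vn_nat_frob n : vabs (n%:R ^+ p - n%:R : K) <= vp.
Proof.
case: n => [|n]; first by rewrite expr0n gtn_eqF// subr0 vn0 vn_ge0.
have nnp : (n.+1 <= n.+1 ^ p)%N by rewrite -{1}[n.+1]expn1 leq_pexp2l.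
have /eqP := fermat_little n.+1 hp; rewrite eqn_mod_dvd// => /dvdnP[k E].
by rewrite -natrX -natrB// E natrM vnM ler_piMl ?vn_ge0// vn_nat_le1.
Qed.

(** The congruence x^p = x modulo p fails for general integral x of K. It holds for integral
    rationals, and the Artin-Hasse coefficients are nonnegative ones. *)
Definition natratio (x : K) := exists m d : nat, (0 < d)%N /\ x * d%:R = m%:R.

(** In lowest terms m'/d', integrality forces d' to be prime to p; multiplying by the unit d'^p
    reduces the claim to Fermat's little theorem. *)
Lemma natratio_frob x : natratio x -> vabs x <= 1 -> vabs (x ^+ p - x) <= vp.
Proof.
move=> [m [d [d0 xd]]] x1.
have g0 : (0 < gcdn m d)%N by rewrite gcdn_gt0 d0 orbT.
pose m' := (m %/ gcdn m d)%N; pose d' := (d %/ gcdn m d)%N.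
have cop : coprime m' d'.
  by rewrite /coprime -(eqn_pmul2r g0) muln_gcdl !divnK ?dvdn_gcdl ?dvdn_gcdr// mul1n.
have xd' : x * d'%:R = m'%:R.
  have gn : (gcdn m d)%:R != 0 :> K by rewrite natr_eq0K -lt0n.
  by apply: (mulIf gn); rewrite -mulrA -!natrM !divnK ?dvdn_gcdl ?dvdn_gcdr.
have pd' : ~~ (p %| d')%N.
  apply/negP => pd'; have pm' : coprime p m'.
    by rewrite prime_coprime//; apply: contraL cop => pm'; apply/negP => /eqP cop;
      have := dvdn_gcd p m' d'; rewrite pm' pd' cop dvdn1 gtn_eqF.
  have := vn_nat_coprime K hp pm'; rewrite -xd' => E.
  have : vabs (x * d'%:R) < 1.
    case/dvdnP: pd' => k ->; rewrite natrM mulrA vnM.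
    apply: le_lt_trans (vnp_lt1 K hp); rewrite ler_piMl ?vn_ge0//.
    by apply: vn_M_le1 => //; exact: vn_nat_le1.
  by rewrite E ltxx.
have ud' : vabs (d'%:R : K) = 1 by rewrite vn_nat_coprime// prime_coprime.
have -> : vabs (x ^+ p - x) = vabs ((x ^+ p - x) * d'%:R ^+ p).
  by rewrite vnM vnX ud' expr1n mulr1.
have -> : (x ^+ p - x) * d'%:R ^+ p =
    (m'%:R ^+ p - m'%:R) - x * (d'%:R ^+ p - d'%:R) by rewrite -xd' exprMn; ring.
apply: vnB_le; first exact: vn_nat_frob.
by rewrite vnM; apply: le_trans (vn_nat_frob d'); rewrite ler_piMl// vn_ge0.
Qed.

Lemma natratioD x y : natratio x -> natratio y -> natratio (x + y).
Proof.
move=> [m [d [d0 xd]]] [m' [d' [d'0 yd]]].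
exists (m * d' + m' * d)%N, (d * d')%N; rewrite muln_gt0 d0; split => //.
by rewrite natrD !natrM -xd -yd; ring.
Qed.

Lemma natratio_nat n : natratio n%:R.
Proof. by exists n, 1%N; rewrite mulr1. Qed.

Lemma natratio_divn x n : (0 < n)%N -> natratio (n%:R * x) -> natratio x.
Proof.
move=> n0 [m [d [d0 xd]]]; exists m, (n * d)%N; rewrite muln_gt0 n0 d0; split => //.
by rewrite -xd natrM; ring.
Qed.

Lemma natratio_sum (I : Type) (r : seq I) (P : pred I) (F : I -> K) :
  (forall i, P i -> natratio (F i)) -> natratio (\sum_(i <- r | P i) F i).
Proof.
move=> H; elim/big_ind : _ => //; first exact: (natratio_nat 0).
exact: natratioD.
Qed.

Lemma ps_monomialX (x : K) k i : ((ps_monomial x 1 : fps K) ^+ k) i = x ^+ k *+ (i == k).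
Proof.
elim: k i => [|k ih] i; first by rewrite !expr0 fps1.
rewrite exprS fps_monomialM; case: i => [//|i] /=.
by rewrite subn1 ih eqSS exprS mulrnAr.
Qed.

Lemma fps_exp_monomial (x : K) i : fps_exp (ps_monomial x 1) i = x ^+ i / (i`!)%:R.
Proof.
rewrite (fps_expE _ (leqnn i))// big_ord_recr/= ps_monomialX eqxx mulr1n big1 ?add0r//.
by move=> j _; rewrite ps_monomialX gtn_eqF ?mul0r.
Qed.

Definition ah_log : fps K := lac p (fun i => (p ^ i)%:R^-1).

Definition artin_hasse : fps K := fps_exp ah_log.

Let L0 : ah_log 0%N = 0. Proof. exact: lac0. Qed.

Lemma artin_hasse0 : artin_hasse 0%N = 1. Proof. exact: fps_exp0. Qed.

(** The logarithm L(t) = sum_i t^(p^i) / p^i satisfies p L(t) = L(t^p) + p t. *)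
Lemma artin_hasse_frob : artin_hasse ^+ p =
  (ps_subst_pow p artin_hasse : fps K) * fps_exp (ps_monomial p%:R 1).
Proof.
rewrite -fps_expX// fps_exp_subst// -fps_expD ?ps_subst_pow0//.
congr fps_exp; rewrite lacMn (lac_subst p1) (monomial_lac p1) -lacD; apply: eq_lac => -[|i].
  by rewrite add0r expn0 invr1.
rewrite addr0 expnS natrM invfM -[LHS]mulr_natl mulrA divff ?mul1r//.
by rewrite natr_eq0K -lt0n.
Qed.

(** The differential equation gives i e_i = sum of the e_(i - p^k) over p^k <= i. *)
Lemma artin_hasse_natratio i : natratio (artin_hasse i).
Proof.
elim/ltn_ind: i => -[|i] ih; first by rewrite artin_hasse0; exact: (natratio_nat 1).
apply: (@natratio_divn _ i.+1) => //.
rewrite -eulerE euler_fps_exp// fpsM; apply: natratio_sum => j _.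
have [->|j0] := eqVneq (j : nat) 0%N.
  by rewrite eulerE !mul0r; exact: (natratio_nat 0).
have {}ih : natratio (fps_exp ah_log (i.+1 - j)%N).
  by apply: ih; rewrite ltn_subrL lt0n j0.
rewrite eulerE /ah_log; have [[k jE]|H] := lac_cases p j.
  have -> : j%:R * lac p (fun i => (p ^ i)%:R^-1) j = 1 :> K.
    by rewrite -jE lacE// divff// natr_eq0K -lt0n expn_gt0 p0.
  by rewrite mul1r.
by rewrite lac_out// mulr0 mul0r; exact: (natratio_nat 0).
Qed.

(** |p^i| = o^((p-1) i), |i!| >= o^(i-1), and (p-1) i >= (p-1) + (i-1). *)
Lemma vn_exp_p i : (0 < i)%N -> vabs (fps_exp (ps_monomial (p%:R : K) 1) i) <= vp.
Proof.
move=> i0; have /andP[omega0 omega1] := o01.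
rewrite fps_exp_monomial vnM vnV vnX /vp (vnp K) -op.
rewrite ler_pdivrMr; last by rewrite vn_gt0 natr_eq0K -lt0n fact_gt0.
apply: le_trans (ler_wpM2l _ (fact_lower K hp o01 op i0)); last by rewrite exprn_ge0// ltW.
rewrite -exprM -exprD ler_wiXn2l ?(ltW omega0) ?(ltW omega1)//.
by case: i i0 => // i _; rewrite mulnS leq_add2l/= leq_pmull// -ltnS prednK.
Qed.

(** Written as a sum of monomials so that P(t)^p = P(t^p) modulo p can be proved by adding one
    monomial at a time. *)
Definition ah_trunc n : fps K := \sum_(j < n) (ps_monomial (artin_hasse j) j : fps K).

Lemma ah_truncE n i : ah_trunc n i = if (i < n)%N then artin_hasse i else 0.
Proof.
rewrite /ah_trunc fps_sum; case: ltnP => ni.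
  rewrite (bigD1 (Ordinal ni))//= [X in X + _]/ps_monomial eqxx mulr1n big1 ?addr0//.
  by move=> j; rewrite -val_eqE /= /ps_monomial eq_sym => /negPf ->.
by rewrite big1// => j _; rewrite /ps_monomial gtn_eqF// (leq_trans (ltn_ord j)).
Qed.

Lemma monomialX (x : K) m k : (ps_monomial x m : fps K) ^+ k = ps_monomial (x ^+ k) (m * k).
Proof.
apply/funext => i; elim: k i => [|k ih] i; first by rewrite !expr0 muln0 fps1 /ps_monomial.
rewrite exprS fps_monomialM ih /ps_monomial; case: leqP => mi.
  rewrite mulnS -{2}(subnKC mi) eqn_add2l exprS; by case: eqP; rewrite ?mulr1n// mulr0n mulr0.
by rewrite ltn_eqF ?mulr0n// mulnS (leq_trans mi)// leq_addr.
Qed.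

(* Dwork's lemma: comparing the coefficients of t^n in f(t)^p = f(t^p) exp(pt)
   modulo p gives p f_n = 0 modulo p, once the previous f_j are integral and
   satisfy f_j^p = f_j modulo p. *)
Lemma artin_hasse_le1 n : vabs (artin_hasse n) <= 1.
Proof.
elim/ltn_ind: n => n ih; have [->|n0] := posnP n; first by rewrite artin_hasse0 vn1.
pose P := ah_trunc n; pose T := artin_hasse - P.
have P1 k : (k <= n)%N -> forall i, vabs (ah_trunc k i) <= 1.
  move=> kn i; rewrite ah_truncE; case: ltnP => ik; last by rewrite vn0.
  by apply: ih; apply: leq_trans kn.
have frobP k : (k <= n)%N -> forall i,
    vabs ((ah_trunc k ^+ p - (ps_subst_pow p (ah_trunc k) : fps K)) i) <= vp.
  elim: k => [|k IH] kn i.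
    rewrite /ah_trunc big_ord0 expr0n gtn_eqF// mulr0n sub0r fpsN vnN.
    by rewrite /ps_subst_pow; case: ifP => _; rewrite vn0 vn_ge0.
  set m : fps K := ps_monomial (artin_hasse k) k.
  have m1 j : vabs (m j) <= 1.
    by rewrite /m /ps_monomial; case: eqP => _; rewrite ?vn0// mulr1n ih.
  have -> : ah_trunc k.+1 = ah_trunc k + m by rewrite /ah_trunc big_ord_recr.
  rewrite ps_subst_powD.
  have -> : (ah_trunc k + m) ^+ p - (ps_subst_pow p (ah_trunc k) + ps_subst_pow p m : fps K)
     = ((ah_trunc k + m) ^+ p - (ah_trunc k ^+ p + m ^+ p))
     + (ah_trunc k ^+ p - (ps_subst_pow p (ah_trunc k) : fps K))
     + (m ^+ p - (ps_subst_pow p m : fps K)) by ring.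
  rewrite 2!fpsD; apply: vnD_le; first apply: vnD_le.
  - by apply: fps_frob_add => // j; apply: P1; apply: ltnW.
  - by apply: IH; apply: ltnW.
  - rewrite fpsB ps_subst_pow_monomial// monomialX /ps_monomial -mulrnBl.
    case: eqP => _; rewrite ?mulr0n ?vn0 ?vn_ge0// mulr1n.
    by apply: natratio_frob; [exact: artin_hasse_natratio|exact: ih].
have T0 j : (j < n)%N -> T j = 0.
  by move=> jn; rewrite /T fpsB /P ah_truncE jn subrr.
have Tn : T n = artin_hasse n by rewrite /T fpsB /P ah_truncE ltnn subr0.
have P0 : P 0%N = 1 by rewrite /P ah_truncE n0 artin_hasse0.
(* f^p - P^p is f - P = f_n t^n + ... times a sum of p products with constant term 1, so only p f_n
   reaches t^n. *)
have pE : p%:R * artin_hasse n = (artin_hasse ^+ p) n - (P ^+ p) n.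
  rewrite -fpsB subrXX -/T fpsM big_ord_recr/= big1 ?add0r; last first.
    by move=> j _; rewrite T0// mul0r.
  rewrite Tn subnn fps_sum mulrC; congr (_ * _).
  rewrite (eq_bigr (fun=> 1)) ?sumr_const ?card_ord// => j _.
  by rewrite fpsM0 !fpsX0 artin_hasse0 P0 !expr1n mulr1.
suff : vabs (p%:R * artin_hasse n) <= vp.
  by rewrite vnM ger_pMr// vn_gt0 natr_eq0K -lt0n.
rewrite pE artin_hasse_frob fpsM big_ord_recr/= subnn fps_exp0// mulr1 -addrA.
apply: vnD_le.
  apply: vn_sum_le => [|j _]; first exact: vn_ge0.
  rewrite vnM; apply: (@le_trans _ _ (vabs (fps_exp (ps_monomial (p%:R : K) 1) (n - j)%N))).
    rewrite ler_piMl ?vn_ge0// /ps_subst_pow; case: ifP => _; last by rewrite vn0.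
    by apply: ih; apply: leq_ltn_trans (leq_div _ _) _.
  by apply: vn_exp_p; rewrite subn_gt0.
have -> : ps_subst_pow p artin_hasse n = ps_subst_pow p P n.
  rewrite /ps_subst_pow; case: ifP => // _.
  by rewrite /P ah_truncE ltn_Pdiv.
by rewrite vnB; exact: frobP.
Qed.

End dwork_lemma.

(** * Dwork's splitting functions *)

(** For i = k + 2 this bounds |pi0^(p^i) / p^i| = o^(p^i - (p-1) i) by o^(1 + p^k). *)
Lemma tail_exp_le p k : (1 < p)%N -> (1 + p ^ k + p.-1 * k.+2 <= p ^ k.+2)%N.
Proof.
case: p => [|[|q]]// _; elim: k => [|k ih] /=.
  by rewrite expn0 !expnS expn0; nia.
have : (0 < q.+2 ^ k)%N by rewrite expn_gt0.
move: ih; rewrite !expnS /=; move: (q.+2 ^ k)%N => x; nia.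
Qed.

Section dwork_series.
Context (R : realType) (p : nat) (K : padicComplex R p).
Hypothesis hp : prime p.
Context (pi0 : K).
Hypothesis hpi0 : series (fun i => pi0 ^+ (p ^ i) / (p ^ i)%:R) @ \oo --> (0 : K).
Hypothesis hpi0_ord : ord pi0 = (p.-1%:R)^-1.

Let p0 : (0 < p)%N. Proof. exact: prime_gt0. Qed.
Let p1 : (1 < p)%N. Proof. exact: prime_gt1. Qed.
Let natr_eq0K := natr_eq0K K hp.
Let o := vabs pi0.

(** The default value 0 of [ord] at 0 differs from 1/(p-1), so pi0 is nonzero. *)
Lemma vn_pi0_gt0 : 0 < o.
Proof.
rewrite lt_neqAle vn_ge0 andbT; apply/negP => /eqP o0.
have := hpi0_ord; rewrite /ord -/o -o0 ln0// oppr0 mul0r => /eqP.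
by rewrite eq_sym invr_eq0 pnatr_eq0 gtn_eqF// -subn1 subn_gt0.
Qed.

Lemma vn_pi0X : o ^+ p.-1 = p%:R^-1.
Proof.
have q0 : p.-1%:R != 0 :> R by rewrite pnatr_eq0 -lt0n -subn1 subn_gt0.
have lp : ln (p%:R : R) != 0 by rewrite gt_eqF// ln_gt0// ltr1n.
apply: ln_inj; rewrite ?posrE ?exprn_gt0 ?invr_gt0 ?ltr0n ?vn_pi0_gt0//.
rewrite lnXn ?vn_pi0_gt0// lnV ?posrE ?ltr0n//.
have := hpi0_ord; rewrite /ord -/o => /(congr1 (fun x => x * ln p%:R)).
rewrite divfK// => /(congr1 -%R); rewrite opprK => ->.
by rewrite -[LHS]mulr_natl mulrN mulrA divff// mul1r.
Qed.

Lemma vn_pi0_01 : 0 < o < 1.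
Proof.
rewrite vn_pi0_gt0 ltNge; apply/negP => o1.
have := exprn_ege1 p.-1 o1; rewrite vn_pi0X leNgt invf_lt1 ?ltr0n//.
by rewrite ltr1n p1.
Qed.

Let o01 := vn_pi0_01.
Let op := vn_pi0X.

Lemma pi0_neq0 : pi0 != 0. Proof. by rewrite -vn_gt0 vn_pi0_gt0. Qed.

Let c i : K := pi0 ^+ (p ^ i) / (p ^ i)%:R.

Lemma theta_logE : theta_log pi0 = lac p c.
Proof.
apply/funext => m; rewrite /theta_log /lac; apply: eq_bigr => i /eqP mE.
by rewrite /c mE.
Qed.

Lemma theta_log_scale : theta_log pi0 = fps_scale pi0 (ah_log K).
Proof.
apply/funext => m; rewrite /theta_log /fps_scale /ah_log /lac mulr_sumr.
exact: eq_bigr.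
Qed.

(** theta(t) is the Artin-Hasse exponential at pi0 t. *)
Lemma vn_theta i : vabs (theta pi0 i) <= o ^+ i.
Proof.
rewrite /theta -/(fps_exp _) theta_log_scale fps_exp_scale; last exact: (lac0 p1).
rewrite /fps_scale.
rewrite vnM vnX ler_piMr ?exprn_ge0 ?vn_ge0//.
exact: (artin_hasse_le1 K hp o01 op).
Qed.

(** The coefficient of t^(p^j) in log theta_hat: the factor theta(t^(p^(j-i))) contributes c_i for
    each i <= j. *)
Definition theta_hat_coef j : K := \sum_(i < j.+1) c i.

Definition theta_hat_log : fps K := lac p theta_hat_coef.

Let X : fps K := ps_monomial pi0 1.

Let theta_hat_log0 : theta_hat_log 0%N = 0. Proof. exact: lac0. Qed.
Let X0 : X 0%N = 0. Proof. by []. Qed.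
Let theta_log0 : theta_log pi0 0%N = 0. Proof. by rewrite theta_logE lac0. Qed.

Lemma theta_hat_log_functional :
  theta_hat_log = (theta_log pi0 : fps K) + (ps_subst_pow p theta_hat_log : fps K).
Proof.
rewrite theta_logE /theta_hat_log (lac_subst p1) -lacD; apply: eq_lac => -[|j].
  by rewrite /theta_hat_coef big_ord1 addr0.
by rewrite /theta_hat_coef big_ord_recr/= addrC.
Qed.

Lemma theta_hat_log_iter n :
  theta_hat_log = \sum_(j < n) (ps_subst_pow (p ^ j) (theta_log pi0) : fps K) +
  (ps_subst_pow (p ^ n) theta_hat_log : fps K).
Proof.
elim: n => [|n ih].
  rewrite big_ord0 add0r; apply/funext => i.
  by rewrite /ps_subst_pow expn0 dvd1n divn1.
rewrite {1}ih big_ord_recr/= -addrA; congr (_ + _).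
rewrite {1}theta_hat_log_functional ps_subst_powD; congr (_ + _).
by rewrite ps_subst_pow_comp ?expn_gt0 ?p0// expnSr.
Qed.

(** The factors left out of the product change the logarithm only from t^(p^(i+1)) on, beyond
    t^i. *)
Lemma theta_hatE : theta_hat pi0 = fps_exp theta_hat_log.
Proof.
apply/funext => i.
have prodE n : \prod_(j < n) (ps_subst_pow (p ^ j) (theta pi0) : fps K) =
    fps_exp (\sum_(j < n) (ps_subst_pow (p ^ j) (theta_log pi0) : fps K)).
  elim: n => [|n ih]; first by rewrite !big_ord0 fps_exp_0.
  rewrite !big_ord_recr/= ih fps_expD//.
  - by rewrite /theta -/(fps_exp _) fps_exp_subst// expn_gt0 p0.
  - by rewrite fps_sum big1// => j _; rewrite ps_subst_pow0.
  - by rewrite ps_subst_pow0.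
transitivity ((\prod_(j < i.+1) (ps_subst_pow (p ^ j) (theta pi0) : fps K)) i) => //.
rewrite prodE; apply: fps_exp_ext => //.
  by rewrite fps_sum big1// => j _; rewrite ps_subst_pow0.
move=> k ki; rewrite (theta_hat_log_iter i.+1) fpsD [X in _ + X](_ : _ = 0) ?addr0//.
have [->|k0] := posnP k; first by rewrite ps_subst_pow0.
rewrite /ps_subst_pow gtnNdvd// (leq_ltn_trans ki)//.
by apply: ltn_trans (ltn_expl i.+1 p1).
Qed.

Definition theta_hat1_log : fps K := theta_hat_log - X.

Let B0 : theta_hat1_log 0%N = 0. Proof. by rewrite /theta_hat1_log fpsB theta_hat_log0 X0 subr0. Qed.

Lemma theta_hat1_seriesE : theta_hat1_series pi0 = fps_exp theta_hat1_log.
Proof.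
rewrite /theta_hat1_series theta_hatE /theta_hat1_log fps_expD// ?fpsN ?X0 ?oppr0//.
congr (ps_mul _ _); rewrite -[LHS](@mul1r (fps K)) -(fps_expN natr_eq0K X0).
rewrite mulrAC [X in X * _]ps_invE ?mul1r//; exact: fps_exp0.
Qed.

Lemma sigmaE : sigma pi0 = fps_exp (X - (ps_subst_pow p X : fps K)).
Proof. by rewrite /sigma /X ps_subst_pow_monomial// mul1n. Qed.

Lemma theta_sigma :
  (theta pi0 : fps K) * (ps_subst_pow p (theta_hat1_series pi0) : fps K) =
  (theta_hat1_series pi0 : fps K) * (sigma pi0 : fps K).
Proof.
rewrite theta_hat1_seriesE sigmaE fps_exp_subst// /theta -/(fps_exp _).
have pX0 : (ps_subst_pow p X : fps K) 0%N = 0 by rewrite ps_subst_pow0.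
rewrite -!fps_expD// ?ps_subst_pow0// ?fpsB ?pX0 ?X0 ?subr0//.
congr fps_exp; rewrite /theta_hat1_log ps_subst_powD ps_subst_powN {2}theta_hat_log_functional.
by ring.
Qed.

(** The series in [hpi0] sums to 0, so this partial sum is minus a tail. The tail is cut at an n for
    which the partial sum is already below B. *)
Lemma vn_theta_hat_coef j : vabs (theta_hat_coef j.+1) <= o * o ^+ (p ^ j).
Proof.
have /andP[omega0 omega1] := o01.
pose B := o * o ^+ (p ^ j); have B0' : 0 < B by rewrite mulr_gt0// exprn_gt0.
have vc i : (j.+1 < i)%N -> vabs (c i) <= B.
  case: i => [|[|k]]// jk; rewrite vnM vnV vnX natrX vnX (vnp K).
  rewrite -exprVn invrK -/o.
  have -> : (p%:R : R) = (o ^+ p.-1)^-1 by rewrite op invrK.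
  rewrite exprVn -exprM ler_pdivrMr ?exprn_gt0// /B -exprS -exprD.
  rewrite ler_wiXn2l ?(ltW omega0) ?(ltW omega1)//.
  apply: leq_trans (tail_exp_le k p1); rewrite leq_add2r add1n ltnS leq_pexp2l//.
have /cvg_ballP/(_ _ B0')[M _ HM] := hpi0.
pose n := maxn M j.+2.
have := HM n (leq_maxl _ _); rewrite /= ballK sub0r vnN /series/= => Sn.
have jn : (j.+2 <= n)%N by rewrite leq_maxr.
have E : \sum_(0 <= i < n) c i = theta_hat_coef j.+1 + \sum_(j.+2 <= i < n) c i.
  by rewrite (big_cat_nat (leq0n _) jn)/= big_mkord.
have -> : theta_hat_coef j.+1 = \sum_(0 <= i < n) c i - \sum_(j.+2 <= i < n) c i.
  by rewrite E addrK.
apply: vnB_le; first exact: ltW.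
rewrite big_seq; apply: vn_sum_le; first exact: ltW.
by move=> i; rewrite mem_index_iota => /andP[/vc].
Qed.

(** Subtracting pi0 t removes the coefficient that is not small enough; at t^(p^(k+1)) the bound o
    o^(p^k) equals o r^(p^(k+1)) for r = o^(1/p). *)
Lemma theta_hat1_log_bound : exists r : R, 0 < r < 1 /\
  forall i, vabs (theta_hat1_log i) <= o * r ^+ i.
Proof.
have [r [r01 rp]] := exp_root p0 o01; exists r; split => // i.
have /andP[r0 r1] := r01; have /andP[omega0 _] := o01.
rewrite /theta_hat1_log fpsB /X (monomial_lac p1) /theta_hat_log; have [[k <-]|H] := lac_cases p i; last first.
  by rewrite !lac_out// subrr vn0 mulr_ge0// ?exprn_ge0// ltW.
rewrite !lacE//; case: k => [|k].
  rewrite /theta_hat_coef big_ord1 /c expn0 expr1 divr1 subrr vn0 mulr_ge0// ?exprn_ge0// ltW//.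
by rewrite subr0; apply: le_trans (vn_theta_hat_coef k) _; rewrite -{2}rp -exprM expnS.
Qed.

Lemma overconvergent_exp (f : fps K) r : 0 < r < 1 -> f 0%N = 0 ->
  (forall i, vabs (f i) <= o * r ^+ i) -> overconvergent (fps_exp f).
Proof.
move=> r01 f0 H; have /andP[r0 r1] := r01; exists 1, r; split => // i.
by rewrite mul1r; apply: (exp_bound hp o01 op (ltW r0) f0 H).
Qed.

Lemma overconvergent_theta : overconvergent (theta pi0).
Proof. by exists 1, o; split => // i; rewrite mul1r vn_theta. Qed.

Lemma overconvergent_theta_hat1 : overconvergent (theta_hat1_series pi0).
Proof.
have [r [r01 H]] := theta_hat1_log_bound; rewrite theta_hat1_seriesE.
exact: overconvergent_exp r01 B0 H.
Qed.

(** The logarithm pi0 t - pi0 t^p has coefficients of size o, for which [exp_bound] gives no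
    decrease; [theta_sigma] is solved for sigma instead. *)
Lemma overconvergent_sigma : overconvergent (sigma pi0).
Proof.
have [r [r01 H]] := theta_hat1_log_bound.
have NB0 : (- theta_hat1_log) 0%N = 0 by rewrite fpsN B0 oppr0.
have inv : overconvergent (fps_exp (- theta_hat1_log)).
  by apply: (overconvergent_exp r01 NB0) => i; rewrite fpsN vnN.
have -> : sigma pi0 = (fps_exp (- theta_hat1_log) *
    ((theta pi0 : fps K) * (ps_subst_pow p (theta_hat1_series pi0) : fps K))) :> fps K.
  by rewrite theta_sigma mulrA theta_hat1_seriesE [fps_exp (- _) * _]mulrC fps_expN ?mul1r.
apply: overconvergentM => //; apply: overconvergentM; first exact: overconvergent_theta.
by apply: overconvergent_subst => //; exact: overconvergent_theta_hat1.
Qed.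

End dwork_series.

(** * The sequence [z]_m pi0^m *)

Section falling.
Context (K : fieldType).

Definition falling (z : K) l := \prod_(i < l) (z - i%:R).

Lemma fallingS z l : falling z l.+1 = falling z l * (z - l%:R).
Proof. by rewrite /falling big_ord_recr. Qed.

Lemma bracket_opp (z : K) l : bracket z (- l%:Z) = falling z l.
Proof.
case: l => [|l]; first by rewrite /= big_geq// invr1 /falling big_ord0.
by rewrite -NegzE /= big_mkord.
Qed.

Lemma bracket_pos (z : K) l : bracket z l%:Z = (\prod_(i < l) (z + i.+1%:R))^-1.
Proof. by rewrite /= big_add1 /= big_mkord. Qed.

Lemma falling_pochhammer (z : K) l : falling z l = (-1) ^+ l * pochhammer (- z) l.
Proof.
elim: l => [|l ih]; first by rewrite /falling /pochhammer !big_ord0 mulr1.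
rewrite fallingS ih /pochhammer big_ord_recr/= exprS; ring.
Qed.

Lemma falling_nat n l : falling (n%:R : K) l = (n ^_ l)%:R.
Proof.
elim: l => [|l ih]; first by rewrite /falling big_ord0.
rewrite fallingS ih ffactnSr natrM; have [ln|nl] := leqP l n; first by rewrite natrB.
by rewrite ffact_small// !mul0r.
Qed.

Lemma bracket_rec (z : K) (m : int) : (0 < m -> z + m%:~R != 0) ->
  (z + m%:~R) * bracket z m = bracket z (m - 1).
Proof.
case: (intP m) => [_|k H|k _].
- by rewrite sub0r -[- 1]/(- 1%:Z) bracket_opp bracket_pos big_ord0 invr1 fallingS
    /falling big_ord0 mul1r mulr1 subr0 addr0.
- have -> : k.+1%:Z - 1 = k%:Z by lia.
  rewrite !bracket_pos big_ord_recr/= invfM mulrC -mulrA mulVf ?mulr1//.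
  exact: H.
- have -> : - k.+1%:Z - 1 = - k.+2%:Z by lia.
  by rewrite !bracket_opp [falling z k.+2]fallingS mulrC mulrNz.
Qed.

Definition qseq (pi0 x : K) (m : int) : K := bracket x m * pi0 ^ m.

Lemma qseq_rec (pi0 x : K) (m : int) : pi0 != 0 ->
  (0 < m -> x + m%:~R != 0) ->
  (x + m%:~R) * qseq pi0 x m = pi0 * qseq pi0 x (m - 1).
Proof.
move=> pi00 H; rewrite /qseq mulrA bracket_rec// mulrCA; congr (_ * _).
by rewrite -{2}[pi0]expr1z -expfzDr// addrC subrK.
Qed.

(** Going up divides by w + n, hence the bound M; going down divides only by x. The cross-multiplied
    form avoids assuming y 0 or y' 0 nonzero. *)
Lemma recurrence_unique (x w : K) (y y' : int -> K) (M : nat) : x != 0 ->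
  (forall i : nat, (0 < i <= M)%N -> w + i%:R != 0) ->
  (forall n : int, n <= M%:Z -> (w + n%:~R) * y n = x * y (n - 1)) ->
  (forall n : int, n <= M%:Z -> (w + n%:~R) * y' n = x * y' (n - 1)) ->
  forall n : int, n <= M%:Z -> y n * y' 0 = y' n * y 0.
Proof.
move=> x0 wi Hy Hy'.
have up (u : int -> K) : (forall n : int, n <= M%:Z -> (w + n%:~R) * u n = x * u (n - 1)) ->
    forall k, (k < M)%N -> (w + k.+1%:R) * u k.+1%:Z = x * u k%:Z.
  by move=> Hu k kM; rewrite (Hu k.+1%:Z)//; congr (_ * u _); lia.
have down (u : int -> K) : (forall n : int, n <= M%:Z -> (w + n%:~R) * u n = x * u (n - 1)) ->
    forall k : nat, x * u (- k.+1%:Z) = (w - k%:R) * u (- k%:Z).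
  move=> Hu k; rewrite -[k%:R in RHS]/(k%:Z%:~R) -mulrNz Hu.
    by congr (_ * u _); lia.
  by lia.
have nonneg k : (k <= M)%N -> y k%:Z * y' 0 = y' k%:Z * y 0.
  elim: k => [|k ih] kM; first by rewrite mulrC.
  apply: (mulfI (wi k.+1 kM)).
  by rewrite !mulrA !up// -!mulrA ih// ltnW.
have nonpos (k : nat) : y (- k%:Z) * y' 0 = y' (- k%:Z) * y 0.
  elim: k => [|k ih]; first by rewrite oppr0 mulrC.
  by apply: (mulfI x0); rewrite !mulrA !down// -!mulrA ih.
by move=> n; case: (intP n) => [_|k kM|k _]; [exact: (nonneg 0%N)|exact: nonneg|exact: nonpos].
Qed.

End falling.

Lemma absz_add_mul_le (a : int) (j d : nat) :
  (`|(a + (j * d)%N%:Z)%R| <= (`|a| + d) * j.+1)%N.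
Proof.
have : (`|(a + (j * d)%N%:Z)%R| <= `|a| + j * d)%N by lia.
move=> h; apply: leq_trans h _; move: `|a|%N => A; nia.
Qed.

(** * Growth of [z]_m pi0^m for a p-integral rational z = a/d *)

Section growth.
Context (R : realType) (p : nat) (K : padicComplex R p).
Hypothesis hp : prime p.
Context (o : R).
Hypotheses (o01 : 0 < o < 1) (op : o ^+ p.-1 = p%:R^-1).
Context (z : K) (a : int) (d : nat).
Hypotheses (pd : coprime p d) (zd : z * d%:R = a%:~R).

Let p0 : (0 < p)%N. Proof. exact: prime_gt0. Qed.
Let natr_eq0K := natr_eq0K K hp.
Let vd : vabs (d%:R : K) = 1. Proof. exact: vn_nat_coprime. Qed.
Let d0 : (0 < d)%N.
Proof.
rewrite lt0n; apply/eqP => d0; move: pd.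
by rewrite d0 /coprime gcdn0 gtn_eqF// prime_gt1.
Qed.

Lemma vn_z_le1 : vabs z <= 1.
Proof. by rewrite -[vabs z]mulr1 -{1}vd -vnM zd vn_int_le1. Qed.

(** Up to the unit d, z + j is the integer a + j d, and a nonzero integer m has p-adic absolute
    value at least the inverse of its ordinary one. *)
Lemma vn_z_lower j : z + j%:R != 0 ->
  vabs (z + j%:R)^-1 <= (`|a|%N + d)%:R * (j.+1)%:R.
Proof.
move=> zj; have E : (z + j%:R) * d%:R = (a + (j * d)%N%:Z)%:~R.
  by rewrite mulrDl zd intrD -natrM.
have n0 : a + (j * d)%N%:Z != 0.
  by rewrite -(intr_eq0K K hp) -E mulf_neq0// natr_eq0K -lt0n.
rewrite vnV -[vabs _]mulr1 -{1}vd -vnM E.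
have := vn_int_lower K hp n0 => lo.
have pos : (0 < `|(a + (j * d)%N%:Z)%R|)%N by rewrite absz_gt0.
apply: (@le_trans _ _ `|(a + (j * d)%N%:Z)%R|%N%:R).
  by rewrite -[X in _ <= X]invrK lef_pV2// posrE ?vn_gt0 ?(intr_eq0K K hp)// invr_gt0 ltr0n.
rewrite -natrM ler_nat; exact: absz_add_mul_le.
Qed.

Lemma falling_lip x y l : vabs x <= 1 -> vabs y <= 1 ->
  vabs (falling x l - falling y l : K) <= vabs (x - y).
Proof.
move=> x1 y1; have f1 k : vabs (falling y k) <= 1.
  elim: k => [|k ih]; first by rewrite /falling big_ord0 vn1.
  by rewrite fallingS; apply: vn_M_le1 => //; apply: vnB_le => //; exact: vn_nat_le1.
elim: l => [|l ih]; first by rewrite /falling !big_ord0 subrr vn0 vn_ge0.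
have -> : falling x l.+1 - falling y l.+1 =
    (falling x l - falling y l) * (x - l%:R) + falling y l * (x - y).
  by rewrite !fallingS; ring.
apply: vnD_le; rewrite vnM; last by rewrite ler_piMl ?vn_ge0.
apply: le_trans ih; rewrite ler_piMr ?vn_ge0//.
by apply: vnB_le => //; exact: vn_nat_le1.
Qed.

Lemma approx_nat s : exists n : nat, vabs (z - n%:R) <= p%:R^-1 ^+ s.
Proof.
(* u is an inverse of d modulo p^s; the approximating n is the residue of a u. *)
have /(coprimeP _ d0)[[u w] /= uw] : coprime d (p ^ s) by rewrite coprime_sym coprimeXl.
have ps0 : (p ^ s)%N%:Z != 0 by rewrite -lt0n expn_gt0 p0.
have [q [r [rE r0]]] : exists q r : int, a * u%:Z = q * (p ^ s)%N%:Z + r /\ 0 <= r.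
  exists (a * u%:Z %/ (p ^ s)%N%:Z)%Z, (a * u%:Z %% (p ^ s)%N%:Z)%Z.
  by split; [exact: divz_eq|exact: modz_ge0].
exists `|r|%N.
have -> : z - `|r|%N%:R = (z * d%:R) * u%:R - z * (w%:R * p%:R ^+ s) - `|r|%N%:R.
  congr (_ - _); rewrite -mulrA -mulrBr -natrX -!natrM mulnC -natrB ?uw ?mulr1//.
  by rewrite ltnW// -subn_gt0 uw.
have -> : z * d%:R * u%:R - z * (w%:R * p%:R ^+ s) - `|r|%N%:R =
    (q%:~R - z * w%:R) * p%:R ^+ s.
  rewrite zd; have -> : a%:~R * u%:R = (a * u%:Z)%:~R :> K by rewrite intrM.
  have -> : `|r|%N%:R = r%:~R :> K by rewrite -[in RHS](gez0_abs r0).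
  rewrite rE intrD intrM -[(p ^ s)%N%:~R]/((p ^ s)%N%:R) natrX; ring.
rewrite vnM vnX (vnp K) ler_piMl ?exprn_ge0 ?invr_ge0//.
apply: vnB_le; first exact: vn_int_le1.
by apply: vn_M_le1; [exact: vn_z_le1|exact: vn_nat_le1].
Qed.

(** At a natural number n the falling factorial is l! times a binomial coefficient; the bound passes
    to z by p-adic approximation. *)
Lemma falling_bound l : vabs (falling z l) <= vabs ((l`!)%:R : K).
Proof.
have l0 : 0 < vabs ((l`!)%:R : K) by rewrite vn_gt0 natr_eq0K -lt0n fact_gt0.
have p01 : 0 < (p%:R^-1 : R) < 1.
  by rewrite invr_gt0 ltr0n p0 invf_lt1 ?ltr0n// ltr1n prime_gt1.
have [s /(_ s (leqnn s)) Hs] := geo_lt ler01 p01 l0.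
have [n Hn] := approx_nat s.
apply: (@vnK_le _ _ _ (falling n%:R l)).
  apply: le_trans (falling_lip _ vn_z_le1 (vn_nat_le1 _ _)) _.
  by apply: le_trans Hn _; rewrite -[X in X <= _]mul1r ltW.
by rewrite falling_nat -bin_ffact natrM vnM ler_piMl ?vn_ge0// vn_nat_le1.
Qed.

(* By partial fractions k! / prod_(i <= k) (x + i) is an integral combination
   of the 1 / (x + i). *)
Lemma inv_rising_bound k (x : K) (B : R) :
  (forall j, (j <= k)%N -> x + j%:R != 0) ->
  (forall j, (j <= k)%N -> vabs (x + j%:R)^-1 <= B) ->
  vabs ((k`!)%:R / \prod_(i < k.+1) (x + i%:R)) <= B.
Proof.
elim: k x => [|k ih] x xn xB.
  by rewrite big_ord1 mul1r; exact: xB.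
have ih1 := ih x (fun j jk => xn j (leqW jk)) (fun j jk => xB j (leqW jk)).
have ih2 : vabs ((k`!)%:R / \prod_(i < k.+1) (x + 1 + i%:R)) <= B.
  by apply: ih => j jk; rewrite -addrA nat1r; [exact: xn|exact: xB].
(* The two products on the right differ in their end factors only, x and x + k + 1, whose difference
   is k + 1. *)
suff -> : (k.+1)`!%:R / \prod_(i < k.+2) (x + i%:R) =
    (k`!)%:R / \prod_(i < k.+1) (x + i%:R) -
    (k`!)%:R / \prod_(i < k.+1) (x + 1 + i%:R) by exact: vnB_le.
rewrite [in LHS]big_ord_recr/=.
have PE : \prod_(i < k.+1) (x + i%:R) * (x + k.+1%:R) =
    x * \prod_(i < k.+1) (x + 1 + i%:R).
  rewrite -[LHS](big_ord_recr k.+1 (fun i : 'I_k.+2 => x + i%:R))/= big_ord_recl/= addr0.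
  by congr (_ * _); apply: eq_bigr => i _; rewrite /bump/= add1n -addrA nat1r.
have A0 : \prod_(i < k.+1) (x + i%:R) != 0.
  by apply/prodf_neq0 => i _; apply: xn; rewrite ltnW// ltn_ord.
have x0 : x != 0 by have := xn 0%N isT; rewrite addr0.
have xk : x + k.+1%:R != 0 by exact: xn.
have A1 : \prod_(i < k.+1) (x + 1 + i%:R) = \prod_(i < k.+1) (x + i%:R) * (x + k.+1%:R) / x.
  by rewrite PE mulrC mulKf.
rewrite A1 factS natrM; move: A0 => /=.
move: (\prod_(i < k.+1) (x + i%:R)) => A A0; rewrite -natr1; field.
by rewrite A0 x0 natr1 xk.
Qed.

Context (pi0 : K).
Hypothesis pi0o : vabs pi0 = o.

Let pi00 : pi0 != 0. Proof. by rewrite -vn_gt0 pi0o; case/andP: o01. Qed.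

Lemma linear_growth_qseq : linear_growth (qseq pi0 z).
Proof.
have /andP[omega0 omega1] := o01.
(* p comes from [fact_upper] (m < 0), |a| + d from [vn_z_lower] (m > 0), and 1 from m = 0. *)
exists (p%:R + (`|a|%N + d)%:R + 1); first by rewrite !addr_ge0.
move=> m; case: (intP m) => [|k|k].
- rewrite /qseq bracket_pos big_ord0 invr1 mul1r expr0z vn1 mulr1.
  by rewrite lerDr addr_ge0.
- rewrite /qseq bracket_pos vnM -[pi0 ^ _]/(pi0 ^+ k.+1) vnX pi0o absz_nat.
  (* A vanishing product, as for z = -1, makes the bracket 0 by convention. *)
  have [/eqP pr0|/prodf_neq0 prn] := boolP (\prod_(i < k.+1) (z + i.+1%:R) == 0).
    by rewrite pr0 invr0 vn0 mul0r mulr_ge0// !addr_ge0.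
  have zi j : (j <= k)%N -> z + 1 + j%:R != 0.
    by move=> jk; have := prn (Ordinal (jk : (j < k.+1)%N)) isT; rewrite /= -addrA nat1r.
  have B0 : vabs ((k`!)%:R / \prod_(i < k.+1) (z + 1 + i%:R)) <=
      (`|a|%N + d)%:R * k.+2%:R.
    apply: inv_rising_bound => // j jk; rewrite -addrA nat1r.
    apply: le_trans (vn_z_lower _) _; first by rewrite -nat1r addrA zi.
    by rewrite ler_wpM2l// ler_nat.
  have -> : \prod_(i < k.+1) (z + i.+1%:R) = \prod_(i < k.+1) (z + 1 + i%:R).
    by apply: eq_bigr => i _; rewrite -addrA nat1r.
  apply: (@le_trans _ _ ((`|a|%N + d)%:R * k.+2%:R)); last first.
    by rewrite ler_wpM2r// -addrA addrCA lerDl addr_ge0.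
  apply: le_trans _ B0; rewrite vnM mulrC ler_wpM2r ?vn_ge0//.
  apply: le_trans (fact_lower_weak K hp o01 op k).
  by rewrite ler_wiXn2l ?(ltW omega0) ?(ltW omega1).
- rewrite /qseq bracket_opp vnM -[pi0 ^ _]/((pi0 ^+ k.+1)^-1) vnV vnX pi0o abszN absz_nat.
  rewrite ler_pdivrMr ?exprn_gt0//.
  apply: le_trans (falling_bound k.+1) _.
  apply: le_trans (fact_upper K hp o01 op k.+1) _.
  by rewrite ler_wpM2r ?exprn_ge0 ?(ltW omega0)// ler_wpM2r// -addrA lerDl addr_ge0.
Qed.

End growth.

(** * The identity in one variable *)

Lemma negz_sub_gt0 (m c : nat) : (0 < Negz m - c%:Z) = false.
Proof. lia. Qed.

Section one_variable.
Context (R : realType) (p : nat) (K : padicComplex R p).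
Hypothesis hp : prime p.
Context (pi0 : K).
Hypothesis hpi0 : series (fun i => pi0 ^+ (p ^ i) / (p ^ i)%:R) @ \oo --> (0 : K).
Hypothesis hpi0_ord : ord pi0 = (p.-1%:R)^-1.

Let p0 : (0 < p)%N. Proof. exact: prime_gt0. Qed.
Let natr_eq0K := natr_eq0K K hp.
Let pi00 : pi0 != 0. Proof. exact: pi0_neq0. Qed.
Let theta_ov := overconvergent_theta hp hpi0_ord.
Let b_ov := overconvergent_theta_hat1 hp hpi0 hpi0_ord.
Let sigma_ov := overconvergent_sigma hp hpi0 hpi0_ord.
Let sg : fps K := sigma pi0.
Let b : fps K := theta_hat1_series pi0.

Lemma g_conv (v : rat) l : linear_growth (qseq pi0 (ratr v)) ->
  g pi0 v l * pi0 ^ l = lconv b (qseq pi0 (ratr v)) l.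
Proof.
move=> ql; suff -> : g pi0 v l = pi0 ^ (- l) * lconv b (qseq pi0 (ratr v)) l.
  by rewrite mulrAC -expfzDr// addNr expr0z mul1r.
apply: geo_sum_sumn_inf.
have := geo_sumZ (pi0 ^ (- l)) (lconv_sum l b_ov ql).
congr geo_sum; apply/funext => i; rewrite /theta_hat1 /qseq -/b.
rewrite expfzDr// [pi0 ^ (- i%:Z)](_ : _ = (pi0 ^+ i)^-1); last by rewrite -exprnN.
have i0 : (i`!)%:R != 0 :> K by rewrite natr_eq0K -lt0n fact_gt0.
have pl : pi0 ^ (- l) * pi0 ^ l = 1 by rewrite -expfzDr// addNr expr0z.
transitivity (pi0 ^ (- l) * pi0 ^ l * (bracket (ratr v) (l - i%:Z) * b i / pi0 ^+ i)); first ring.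
by rewrite pl mul1r; field; rewrite i0 expf_neq0.
Qed.

(** [0]_m contains the factor 0 for m < 0; this settles the exponents outside E when v_j = 0. *)
Lemma g_eq0 (l : int) : l < 0 -> g pi0 0 l = 0.
Proof.
move=> l0; apply: geo_sum_sumn_inf.
have := @geo_sum_finite _ _ K (fun=> 0) 0; rewrite big_ord0.
rewrite [X in geo_sum X](_ : _ = fun i => bracket (ratr 0) (l - i%:Z) * theta_hat1 pi0 i / (i`!)%:R); first exact.
apply/funext => i.
have -> : l - i%:Z = - (`|l|%N + i)%N.-1.+1%:Z by lia.
rewrite bracket_opp /falling big_ord_recl/= [ratr 0](ratr_int _ 0) subrr.
by rewrite !mul0r.
Qed.

Section range.
Context (z : K).
Hypothesis ql : linear_growth (qseq pi0 z).
Context (M : nat).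
Hypothesis zM : forall i : nat, (0 < i <= M)%N -> p%:R * z + i%:R != 0.

Let q := qseq pi0 z.
Let y := lconv sg (frob q).

(** Q_v(t^p) is annihilated by t d/dt - p pi0 t^p. If p does not divide n, both sides are 0. *)
Lemma frob_rec (n : int) : n <= M%:Z ->
  (p%:R * z + n%:~R) * frob q n = p%:R * pi0 * frob q (n - p%:Z).
Proof.
move=> nM; rewrite /frob; case: ifPn => [/dvdzP[k nE]|pn]; last first.
  rewrite ifF ?mulr0//; apply/negP => pnp; move/negP: pn; apply.
  by rewrite -[n](subrK p%:Z); apply: rpredD => //; exact: dvdzz.
rewrite nE -[X in _ - X]mul1r -mulrBl dvdz_mull// !mulzK//; last by case: (p) p0.
  rewrite intrM mulrC; have -> : p%:R * z + k%:~R * p%:Z%:~R = p%:R * (z + k%:~R) by ring.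
  rewrite mulrC -!mulrA qseq_rec// => k0.
  have ppos : 0 < p%:Z :> int by rewrite ltz_nat.
  have pk : (0 < p * `|k| <= M)%N.
    by rewrite muln_gt0 p0 absz_gt0 gt_eqF//= -lez_nat PoszM gtz0_abs// mulrC -nE.
  have := zM pk; apply: contra_neq => zk.
  have -> : (p * `|k|)%N%:R = p%:R * k%:~R :> K.
    by rewrite natrM -[in RHS](gtz0_abs k0).
  by rewrite -mulrDr zk mulr0.
by case: (p) p0.
Qed.

Let Xs : fps K := (ps_monomial pi0 1 : fps K) - (ps_monomial (p%:R * pi0) p : fps K).

Lemma euler_sigma : euler sg = Xs * sg.
Proof.
rewrite /sg sigmaE// euler_fps_exp//; last first.
  by rewrite fpsB ps_subst_pow0 subrr.
congr (_ * _); rewrite ps_subst_pow_monomial// mul1n eulerD eulerN; congr (_ - _).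
  by apply/funext => i; rewrite eulerE /ps_monomial; case: eqP => [->|]; rewrite ?mul1r// !mulr0n mulr0.
by apply/funext => i; rewrite eulerE /ps_monomial; case: eqP => [->|]; rewrite// !mulr0n mulr0.
Qed.

Let fq : linear_growth (frob q). Proof. exact: linear_growth_frob. Qed.
Let yl : linear_growth y. Proof. exact: linear_growth_lconv. Qed.

(* exp(pi0 t - pi0 t^p) Q_v(t^p) is annihilated by t d/dt - pi0 t. *)
Lemma conv_sigma_rec (n : int) : n <= M%:Z ->
  (p%:R * z + n%:~R) * y n = pi0 * y (n - 1).
Proof.
move=> nM; have mo x m := overconvergent_monomial x m.
have Xo : overconvergent Xs.
  by apply: overconvergentD => //; exact: overconvergentN.
(* Leibniz rule for p z + n = i + (p z + n - i): [E1] differentiates sigma, [E2] differentiates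
   Q_v(t^p), and the terms p pi0 y(n - p) cancel. *)
have E1 : geo_sum (fun i => i%:R * sg i * frob q (n - i%:Z))
    (pi0 * y (n - 1) - p%:R * pi0 * y (n - p%:Z)).
  have := lconv_sum n (overconvergentM Xo sigma_ov) fq.
  rewrite -lconvA// lconvD//; last exact: overconvergentN.
  rewrite lconvN// !lconv_monomial -/sg -/y -euler_sigma.
  by congr geo_sum.
have E2 : geo_sum (fun i => sg i * (p%:R * pi0 * frob q (n - i%:Z - p%:Z)))
    (p%:R * pi0 * y (n - p%:Z)).
  have := lconv_sum n sigma_ov (linear_growth_scaled_shift (p%:R * pi0) p fq).
  rewrite lconvZ//; last first.
    have := linear_growth_scaled_shift 1 p fq; congr linear_growth.
    by apply/funext => m; rewrite mul1r.
  by rewrite lconv_shift.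
have := geo_sumD E1 E2; rewrite subrK => E3.
apply: geo_sum_uniq E3; have := geo_sumZ (p%:R * z + n%:~R) (lconv_sum n sigma_ov fq).
congr geo_sum; apply/funext => i.
have niM : n - i%:Z <= M%:Z by apply: le_trans nM; rewrite lerBlDr lerDl.
rewrite -(frob_rec niM) intrD intrN -[i%:Z%:~R]/(i%:R) /sg; ring.
Qed.

(** H arises here: index 0 pairs sigma_(p i) with [z]_(-i) pi0^(-i), and [z]_(-i) = (-1)^i
    (-z)_i. *)
Lemma conv_sigma0 : y 0 = H pi0 (- z).
Proof.
rewrite /H; apply/esym/geo_sum_sumn_inf.
have := lconv_frob p0 0 sigma_ov ql; rewrite mulr0 -/y.
congr geo_sum; apply/funext => i; rewrite /qseq sub0r bracket_opp.
by rewrite falling_pochhammer -exprnN /sg; ring.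
Qed.

End range.

Section main_identity.
Context (z : K) (a : int) (d c : nat) (l : int).
Hypotheses (pd : coprime p d) (zd : z * d%:R = a%:~R).
Hypothesis zi : forall i : nat, (0 < i)%N -> (i%:Z <= l + c%:Z) || (i <= c)%N ->
  p%:R * z + i%:R != 0.

Let z' := p%:R * z + c%:R.

(** In [zi], the range i <= l + c serves to propagate the recurrence, the range i <= c to make
    [z']_(-c) nonzero. *)
Lemma one_variable_identity :
  lconv (theta pi0) (frob (lconv b (qseq pi0 z))) (l + c%:Z) =
  H pi0 (- z) / bracket z' (- c%:Z) * pi0 ^+ c * lconv b (qseq pi0 z') l.
Proof.
have o01 := vn_pi0_01 hp hpi0_ord; have oX := vn_pi0X hp hpi0_ord.
have ql : linear_growth (qseq pi0 z) := linear_growth_qseq hp o01 oX pd zd (erefl _).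
have z'd : z' * d%:R = (p%:Z * a + (c * d)%N%:Z)%:~R.
  by rewrite mulrDl -mulrA zd intrD intrM -natrM.
have q'l : linear_growth (qseq pi0 z') := linear_growth_qseq hp o01 oX pd z'd (erefl _).
pose n := l + c%:Z; pose M := `|Num.max n 0|%N.
have MZ : M%:Z = Num.max n 0 by rewrite gez0_abs// le_max lexx orbT.
have nM : n <= M%:Z by rewrite MZ le_max lexx.
have zM (i : nat) : (0 < i <= M)%N -> p%:R * z + i%:R != 0.
  move=> /andP[i0 iM]; apply: zi => //; apply/orP; left.
  have : i%:Z <= Num.max n 0 by rewrite -MZ.
  by rewrite le_max => /orP[//|]; rewrite lez_nat leqn0 gtn_eqF.
have B0 : bracket z' (- c%:Z) != 0.
  rewrite bracket_opp; apply/prodf_neq0 => i _.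
  rewrite /z' -addrA -natrB ?(ltnW (ltn_ord i))//; apply: zi.
    by rewrite subn_gt0.
  by rewrite leq_subr orbT.
have rec' m : m <= M%:Z -> (p%:R * z + m%:~R) * qseq pi0 z' (m - c%:Z) =
    pi0 * qseq pi0 z' (m - 1 - c%:Z).
  move=> mM; have zm : z' + (m - c%:Z)%:~R = p%:R * z + m%:~R.
    by rewrite intrD intrN /z' -[c%:Z%:~R]/(c%:R); ring.
  rewrite -zm (_ : m - 1 - c%:Z = m - c%:Z - 1); last by rewrite addrAC.
  apply: qseq_rec => [//|mc]; rewrite zm; case: m mM mc {zm} => [m mM mc|m _].
    by apply: zM; move: mc mM; rewrite subr_gt0 ltz_nat lez_nat => /(leq_ltn_trans (leq0n _)) ->.
  by rewrite negz_sub_gt0.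
(* Both sides solve the recurrence with w = p z; the constant is their quotient at m = 0. *)
have yE (m : int) : m <= n -> lconv sg (frob (qseq pi0 z)) m =
    H pi0 (- z) / bracket z' (- c%:Z) * pi0 ^+ c * qseq pi0 z' (m - c%:Z).
  move=> mn; have mM := le_trans mn nM.
  have := recurrence_unique pi00 zM (conv_sigma_rec ql zM) rec' mM.
  rewrite conv_sigma0// sub0r [qseq pi0 z' (- _)]/qseq -exprnN => E.
  have B1 : bracket z' (- c%:Z) / pi0 ^+ c != 0 by rewrite mulf_neq0 ?invr_eq0 ?expf_neq0.
  by apply: (mulIf B1); rewrite E; field; rewrite B0 expf_neq0.
rewrite -lconv_subst_frob// lconvA//; last 2 first.
- exact: overconvergent_subst.
- exact: linear_growth_frob.
rewrite (theta_sigma hp) -lconvA//; last exact: linear_growth_frob.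
rewrite (lconv_ext (q' := fun m => _ * qseq pi0 z' (m - c%:Z)) _ yE) lconvZ//; last first.
  have := linear_growth_scaled_shift 1 c q'l; congr linear_growth.
  by apply/funext => m; rewrite mul1r.
by rewrite lconv_shift /n addrK.
Qed.

End main_identity.
End one_variable.

(** * The one-variable identity for rational exponents in [-1, 0] *)

Section rational_exponent.
Context (R : realType) (p : nat) (K : padicComplex R p).
Hypothesis hp : prime p.
Context (pi0 : K).
Hypothesis hpi0 : series (fun i => pi0 ^+ (p ^ i) / (p ^ i)%:R) @ \oo --> (0 : K).
Hypothesis hpi0_ord : ord pi0 = (p.-1%:R)^-1.

Let p0 : (0 < p)%N. Proof. exact: prime_gt0. Qed.

Lemma ratr_frac (x : rat) (a b : int) : b != 0 -> x * b%:~R = a%:~R ->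
  ratr x * b%:~R = a%:~R :> K.
Proof.
move=> b0 xb; have dx : (denq x)%:~R != 0 :> K by rewrite (intr_eq0K K hp) denq_neq0.
have E : numq x * b = a * denq x.
  by apply/eqP; rewrite -(eqr_int rat) !intrM -xb numqE mulrAC.
by apply: (mulIf dx); rewrite /ratr mulrAC divfK// -!intrM E.
Qed.

Context (v v' : rat) (c : nat).
Hypotheses (hv : -1 <= v <= 0) (hvp : coprime p `|denq v|).
Hypotheses (cp : (c < p)%N) (hvv' : p%:R * v - v' = - c%:R).

Let d := `|denq v|%N.
Let dE : d%:Z = denq v. Proof. by rewrite gez0_abs. Qed.
Let zd : ratr v * d%:R = (numq v)%:~R :> K.
Proof.
rewrite -[d%:R]/(d%:Z%:~R) dE; apply: ratr_frac; first exact: denq_neq0.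
by rewrite numqE.
Qed.

Let v'E : v' = p%:R * v + c%:R.
Proof. by rewrite -[c%:R]opprK -hvv' opprB addrC subrK. Qed.

Lemma ratr_v' : ratr v' = p%:R * ratr v + c%:R :> K.
Proof.
have d0 : d%:R != 0 :> K by rewrite (natr_eq0K K hp) absz_eq0 denq_neq0.
apply: (mulIf d0); rewrite mulrDl -(mulrA p%:R) zd.
rewrite -[d%:R in LHS]/(d%:Z%:~R) (@ratr_frac _ (p%:Z * numq v + (c * d)%N%:Z)).
- by rewrite intrD intrM -natrM.
- by rewrite dE denq_neq0.
rewrite v'E dE mulrDl intrD intrM -mulrA; congr (_ * _ + _).
  by rewrite numqE.
by rewrite -dE -natrM.
Qed.

Lemma ratrN_K : ratr (- v) = - ratr v :> K.
Proof.
have d0 : d%:R != 0 :> K by rewrite (natr_eq0K K hp) absz_eq0 denq_neq0.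
apply: (mulIf d0); rewrite mulNr zd -mulrNz -[d%:R]/(d%:Z%:~R) dE.
apply: ratr_frac; first exact: denq_neq0.
by rewrite mulNr mulrNz numqE.
Qed.

(** With v = a/d, p a = - i d and p prime to d give p | i, so v is the integer - i/p, negative and
    at least -1. *)
Lemma pv_neq0 i : (0 < i)%N -> p%:R * ratr v + i%:R = 0 :> K -> i = p /\ v = -1.
Proof.
move=> i0 E; have d0 : (0 < d)%N by rewrite absz_gt0 denq_neq0.
have Ez : p%:Z * numq v = - (i * d)%N%:Z.
  apply/eqP; rewrite -subr_eq0 opprK -(intr_eq0K K hp) intrD intrM -zd mulrA.
  rewrite -[(i * d)%N%:Z%:~R]/((i * d)%N%:R) natrM -mulrDl.
  by rewrite -[p%:Z%:~R]/(p%:R) E mul0r.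
have pi_dvd : (p %| i)%N.
  rewrite -(Gauss_dvdl i hvp) -/d.
  have : (p%:Z %| (i * d)%N%:Z)%Z.
    by rewrite -[(i * d)%N%:Z]opprK -Ez rpredN dvdz_mulr.
  by [].
case/dvdnP: pi_dvd => t iE.
have nv : numq v = - (t * d)%N%:Z.
  have pz0 : p%:Z != 0 by rewrite eqz_nat -lt0n.
  apply: (mulfI pz0); rewrite Ez iE mulrN -PoszM; congr (- _%:Z); ring.
have vt : v = - t%:R.
  rewrite -[LHS]divq_num_den nv -dE mulrNz PoszM intrM mulNr mulfK//.
  by rewrite intr_eq0 eqz_nat -lt0n.
have t0 : (0 < t)%N by move: i0; rewrite iE muln_gt0 => /andP[].
have t1 : t = 1%N.
  apply/eqP; rewrite eqn_leq t0 andbT.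
  by have /andP[] := hv; rewrite vt lerN2 -[1]/(1%:R) ler_nat.
by rewrite iE vt t1 mul1n.
Qed.

Lemma rational_growth : linear_growth (qseq pi0 (ratr v)).
Proof.
by have := linear_growth_qseq hp (vn_pi0_01 hp hpi0_ord) (vn_pi0X hp hpi0_ord) hvp zd (erefl _).
Qed.

Lemma rational_growth' : linear_growth (qseq pi0 (ratr v')).
Proof.
have z'd : ratr v' * d%:R = (p%:Z * numq v + (c * d)%N%:Z)%:~R :> K.
  by rewrite ratr_v' mulrDl -(mulrA p%:R) zd intrD intrM -natrM.
by have := linear_growth_qseq hp (vn_pi0_01 hp hpi0_ord) (vn_pi0X hp hpi0_ord) hvp z'd (erefl _).
Qed.

Definition Gseq (x : rat) (m : int) : K := g pi0 x m * pi0 ^ m.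

Lemma Gseq_lconv (x : rat) : linear_growth (qseq pi0 (ratr x)) ->
  Gseq x = lconv (theta_hat1_series pi0) (qseq pi0 (ratr x)).
Proof. by move=> ql; apply/funext => m; rewrite /Gseq g_conv. Qed.

Lemma linear_growth_Gseq : linear_growth (Gseq v).
Proof.
rewrite (Gseq_lconv rational_growth); apply: linear_growth_lconv.
  exact: overconvergent_theta_hat1.
exact: rational_growth.
Qed.

(** For v = -1 the singular index p is out of reach, because l <= 0 and c < p. *)
Lemma Gseq_identity (l : int) : (v = -1 -> l <= 0) ->
  lconv (theta pi0) (frob (Gseq v)) (l + c%:Z) =
  H pi0 (ratr (- v)) / bracket (ratr v') (- c%:Z) * (Gseq v' l * pi0 ^ c%:Z).
Proof.
move=> vl; rewrite (Gseq_lconv rational_growth) (Gseq_lconv rational_growth').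
rewrite ratrN_K ratr_v' (one_variable_identity hp hpi0 hpi0_ord hvp zd).
  by rewrite -[pi0 ^ c%:Z]/(pi0 ^+ c) -!mulrA [X in _ * (_ * X)]mulrC.
move=> i i0 ilc; apply/eqP => /(pv_neq0 i0)[iE v1].
move: ilc; rewrite iE [(p <= c)%N]leqNgt cp orbF => /le_trans/(_ (lerD (vl v1) (lexx _))).
by rewrite add0r lez_nat leqNgt cp.
Qed.

End rational_exponent.

(** * Several variables *)

Section multivariate_sum.
Context (R : realType) (p : nat) (K : padicComplex R p).

(** The factors are exchanged one at a time. *)
Lemma vn_prod_sub (I : Type) (r : seq I) (x y : I -> K) (C e : R) :
  0 <= C -> 0 <= e -> (forall i, vabs (x i) <= C) -> (forall i, vabs (y i) <= C) ->
  (forall i, vabs (x i - y i) <= C * e) ->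
  vabs (\prod_(i <- r) x i - \prod_(i <- r) y i) <= C ^+ size r * e.
Proof.
move=> C0 e0 xC yC xy; have yr r' : vabs (\prod_(i <- r') y i) <= C ^+ size r'.
  elim: r' => [|i r' ih]; first by rewrite big_nil vn1.
  by rewrite big_cons vnM exprS ler_pM ?vn_ge0.
elim: r => [|i r ih]; first by rewrite !big_nil subrr vn0 mulr_ge0// exprn_ge0.
rewrite !big_cons /= exprS -mulrA.
set X := \prod_(j <- r) x j in ih *; set Y := \prod_(j <- r) y j in ih *.
have -> : x i * X - y i * Y = x i * (X - Y) + (x i - y i) * Y by ring.
apply: vnD_le; first by rewrite vnM ler_pM ?vn_ge0.
have -> : C * (C ^+ size r * e) = C * e * C ^+ size r by ring.
by rewrite vnM ler_pM ?vn_ge0// yr.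
Qed.

(** A finite set containing the cube of side M contributes a product of partial sums plus terms with
    some coordinate >= M; both errors are O(s^M). *)
Lemma sum_inf_prod (N : nat) (x : K) (u : 'I_N -> nat -> K) :
  (forall j, exists C s : R, [/\ 0 <= C, 0 < s < 1 & forall i, vabs (u j i) <= C * s ^+ i]) ->
  sum_inf (fun k : 'rV[nat]_N => x * \prod_(j < N) u j (k 0 j)) =
  x * \prod_(j < N) sumn_inf (u j).
Proof.
move=> /choice[C0 /choice[s0 H]].
(* A common rate; the default 1/2 keeps it positive even for N = 0. *)
pose s := \big[Order.max/2^-1]_(j < N) s0 j.
have s1 : s < 1.
  by apply: bigmax_lt => [|j _]; [lra|have [_ /andP[]] := H j].
have sj j : s0 j <= s by exact: le_bigmax.
have spos : 0 < s by apply: lt_le_trans (bigmax_ge_id _ _ _ _); rewrite invr_gt0.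
pose C := \sum_(j < N) C0 j + 1.
have C1 : 1 <= C by rewrite lerDr sumr_ge0// => j _; have [] := H j.
have Cge : 0 <= C by apply: le_trans C1.
have Cj j : C0 j <= C.
  rewrite /C (bigD1 j)//= -addrA lerDl addr_ge0// sumr_ge0// => i _.
  by have [] := H i.
have s01 : 0 < s < 1 by rewrite spos.
have uC j i : vabs (u j i) <= C * s ^+ i.
  have [C00 /andP[s00 _] Hj] := H j; apply: le_trans (Hj i) _.
  rewrite ler_pM ?exprn_ge0 ?(ltW s00)// lerXn2r ?nnegrE ?(ltW s00) ?(ltW spos)//.
have SE j M : vabs (sumn_inf (u j) - \sum_(i < M) u j i) <= C * s ^+ M.
  exact: geo_sum_cvg.
have PC j M : vabs (\sum_(i < M) u j i) <= C.
  apply: vn_sum_le => // i _; apply: le_trans (uC j i) _.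
  by rewrite ler_piMr// exprn_ile1// ltW.
have SC j : vabs (sumn_inf (u j)) <= C.
  by have := SE j 0%N; rewrite big_ord0 subr0 expr0 mulr1.
have totF := @summability.totally_filter 'rV[nat]_N.
apply: cvg_lim; first exact: metric_hausdorff.
apply/cvg_ballP => e e0.
have xC0 : 0 <= vabs x * C ^+ N by rewrite mulr_ge0 ?vn_ge0// exprn_ge0.
have [M /(_ M (leqnn M)) HM] := geo_lt xC0 s01 e0.
pose cube : seq 'rV[nat]_N :=
  [seq \row_j (f j : nat) | f : {ffun 'I_N -> 'I_M} in predT].
exists [fset k in cube]%fset => //= A cubeA.
rewrite ballK; apply: le_lt_trans HM.
have ucube : uniq cube.
  rewrite map_inj_uniq ?enum_uniq// => f f' /rowP E; apply/ffunP => j.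
  by apply/val_inj; have := E j; rewrite !mxE.
have mcube (k : 'rV[nat]_N) : (k \in cube) = [forall j, (k 0%R j < M)%N].
  apply/idP/forallP => [/mapP[f _ ->] j|kM]; first by rewrite mxE.
  apply/mapP; exists [ffun j => Ordinal (kM j)]; first by rewrite mem_enum.
  by apply/rowP => j; rewrite mxE ffunE.
pose F (k : 'rV[nat]_N) := \prod_(j < N) u j (k 0 j).
have -> : summability.partial_sum (fun k => x * F k) A =
    x * (\sum_(k <- cube) F k + \sum_(k <- A | k \notin cube) F k).
  rewrite /summability.partial_sum -mulr_sumr -(big_seq_fsetE _ A xpredT F); congr (_ * _).
  rewrite [LHS](bigID (fun k => k \in cube))/=; congr (_ + _).
  rewrite -big_filter; apply: perm_big; apply: uniq_perm => //.
    by rewrite filter_uniq// fset_uniq.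
  move=> k; rewrite mem_filter; apply/andP/idP => [[]//|kc]; split=> //.
  by apply: (fsubsetP cubeA); rewrite !inE.
have -> : \sum_(k <- cube) F k = \prod_(j < N) \sum_(i < M) u j i.
  rewrite bigA_distr_bigA/= big_map big_enum/=; apply: eq_bigr => f _.
  by apply: eq_bigr => j _; rewrite mxE.
rewrite -mulrBr vnM -mulrA ler_wpM2l ?vn_ge0// opprD addrA; apply: vnB_le.
  have := @vn_prod_sub _ (index_enum 'I_N) (fun j => sumn_inf (u j))
    (fun j => \sum_(i < M) u j i) C (s ^+ M) Cge.
  rewrite -sum1_size big_const_ord iter_addn_0 mul1n; apply => //.
  by rewrite exprn_ge0// ltW.
apply: vn_sum_le => [|k]; first by rewrite mulr_ge0// exprn_ge0// ltW.
rewrite mcube negb_forall => /existsP[i]; rewrite -leqNgt => Mi.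
rewrite /F vn_prod; apply: (@le_trans _ _ (\prod_(j < N) (C * s ^+ k 0 j))).
  by apply: ler_prod => j _; rewrite vn_ge0 uC.
rewrite big_split/= prodr_const card_ord ler_wpM2l ?exprn_ge0//.
rewrite -expr_sum ler_wiXn2l ?(ltW spos) ?(ltW s1)//.
by rewrite (bigD1 i)//= (leq_trans Mi)// leq_addr.
Qed.

End multivariate_sum.

Section exponents.
Context (R : realType) (p : nat) (K : padicComplex R p) (N n : nat).
Context (a : 'M[int]_(N, n)) (w : 'cV[rat]_n).
Hypothesis hw : forall j : 'I_N, wform w (ratv (row j a)) = 1.

Lemma wform_wsum (e : 'rV[rat]_N) : wform w (wsum a e) = \sum_j e 0 j.
Proof.
rewrite /wform /wsum -mulmxA mxE; apply: eq_bigr => j _.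
rewrite (_ : (map_mx intr a *m w) j 0 = 1) ?mulr1//.
by have := hw j; rewrite /wform /ratv map_row -row_mul [X in X = _]mxE.
Qed.

Lemma wsumD (e f : 'rV[rat]_N) : wsum a (e + f) = wsum a e + wsum a f.
Proof. exact: mulmxDl. Qed.

Lemma wsumZ (x : rat) (e : 'rV[rat]_N) : wsum a (x *: e) = x *: wsum a e.
Proof. by rewrite /wsum scalemxAl. Qed.

Lemma wsumB (e f : 'rV[rat]_N) : wsum a (e - f) = wsum a e - wsum a f.
Proof. exact: mulmxBl. Qed.

Context (pi0 rho : K) (d : nat).
Hypotheses (hd : (0 < d)%N) (hrho : rho ^+ d = pi0) (pi00 : pi0 != 0).

Let rho0 : rho != 0.
Proof. by apply: contra_neq pi00 => r0; rewrite -hrho r0 expr0n gtn_eqF. Qed.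

(** The floor in [root_pow] is additive only when one of the arguments is integral. *)
Lemma root_powD (r s : rat) : d%:R * r \is a Num.int ->
  root_pow rho d (r + s) = root_pow rho d r * root_pow rho d s.
Proof. by move=> dr; rewrite /root_pow mulrDr floorDzr// expfzDr. Qed.

Lemma root_pow_int (m : int) : root_pow rho d m%:~R = pi0 ^ m.
Proof.
rewrite /root_pow -[d%:R]/(d%:Z%:~R) -intrM intrKfloor -hrho.
by rewrite -exprz_exp.
Qed.

Lemma exprz_sum (I : Type) (r : seq I) (F : I -> int) :
  pi0 ^ (\sum_(i <- r) F i) = \prod_(i <- r) pi0 ^ F i.
Proof. by apply: big_morph => // x y; rewrite expfzDr. Qed.

Lemma Gcoef_mem (E : set 'rV[int]_N) (v : 'rV[rat]_N) (l : 'rV[int]_N) : E l ->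
  Gcoef a pi0 E v (wsum a (v + ratv l)) (v + ratv l) = \prod_(j < N) g pi0 (v 0 j) (l 0 j).
Proof.
move=> El; rewrite /Gcoef.
rewrite (_ : [set _ | _] = [set l]) ?fsbig_set1//.
apply/seteqP; split => [k /= [_ _ /addrI kl]|k /= ->]; last by split.
by apply/rowP => j; have /rowP/(_ j) := kl; rewrite !mxE => /intr_inj.
Qed.

Lemma Gcoef_out (E : set 'rV[int]_N) (v : 'rV[rat]_N) u e :
  (forall l, E l -> wsum a (v + ratv l) = u -> v + ratv l <> e) -> Gcoef a pi0 E v u e = 0.
Proof.
move=> H; rewrite /Gcoef (_ : [set _ | _] = set0) ?fsbig_set0//.
by apply/seteqP; split => [k /= [Ek ku /(H k Ek ku)]|].
Qed.

End exponents.

(** p m <= c < p. This is the constraint of E at the exponents with v_j = -1. *)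
Lemma le0_of_mul (l m : int) (c k p : nat) : l <= 0 -> (c < p)%N ->
  l + c%:Z - k%:Z = p%:Z * m -> m <= 0.
Proof. nia. Qed.

Theorem theorem9p13 (R : realType) (p : nat) (hp : prime p)
  (K : padicComplex R p)
  (N n : nat) (a : 'M[int]_(N, n)) (w : 'cV[rat]_n)
  (hw : forall j : 'I_N, wform w (ratv (row j a)) = 1)
  (Q beta : 'rV[rat]_n)
  (hQ : exists c : 'rV[rat]_N, Q = wsum a c)
  (hbetaQ : exists l : 'rV[int]_N, beta = Q + wsum a (ratv l))
  (hbetaC : relative_interior (opp_cone R a) (map_mx ratr beta))
  (v : 'rV[rat]_N)
  (hv : forall j : 'I_N, -1 <= v 0 j <= 0)
  (hbetav : beta = wsum a v)
  (hvp : forall j : 'I_N, coprime p (absz (denq (v 0 j))))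
  (v' : 'rV[rat]_N)
  (hv' : forall j : 'I_N, -1 <= v' 0 j <= 0)
  (hvv' : forall j : 'I_N, exists2 k : nat,
     (k < p)%N & p%:R * v 0 j - v' 0 j = - k%:R)
  (pi0 : K)
  (hpi0 : series (fun i => pi0 ^+ (p ^ i) / (p ^ i)%:R) @ \oo --> (0 : K))
  (hpi0_ord : ord pi0 = (p.-1%:R)^-1)
  (d : nat) (hd : (0 < d)%N)
  (hdv : forall j : 'I_N, d%:R * v 0 j \is a Num.int)
  (rho : K) (hrho : rho ^+ d = pi0) :
  alpha_star a pi0 (E_of v) v' (wsum a v')
    (Gseries a w pi0 rho d (E_of v) v beta)
  = fscale (root_pow rho d (- (p.-1%:R * wform w beta))
            * \prod_(j < N) (H pi0 (ratr (- v 0 j))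
                / bracket (ratr (v' 0 j) : K)
                    (Num.floor (p%:R * v 0 j - v' 0 j))))
      (Gseries a w pi0 rho d (E_of v) v' (wsum a v')).
Proof.
have pi00 : pi0 != 0 := pi0_neq0 hp hpi0_ord.
have p0 : (0 < p)%N := prime_gt0 hp.
have pQ : p%:R != 0 :> rat by rewrite pnatr_eq0 -lt0n.
have /choice[c Hc] : forall j, exists k : nat, (k < p)%N /\ p%:R * v 0 j - v' 0 j = - k%:R.
  by move=> j; have [k] := hvv' j; exists k.
apply/funext => e; apply/funext => u; rewrite /alpha_star /gamma /fscale.
(* A monomial removed by [gamma] does not occur in G_v' either. *)
case: asboolP => [[l [El eE uE]]|out]; last first.
  rewrite /Gseries; case: asboolP => _; last by rewrite mulr0.
  rewrite Gcoef_out ?mul0r ?mulr0// => l El lu le; apply: out; exists l.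
  by split; rewrite // -wsumD lu.
pose W := \sum_j v 0 j.
have dW : d%:R * W \is a Num.int by rewrite mulr_sumr rpred_sum.
have uE' : u = wsum a e by rewrite uE -wsumD -eE.
have eEj j : e 0 j = p%:R * v 0 j + (c j)%:R + (l 0 j)%:~R.
  have [_ cE] := Hc j; rewrite eE !mxE; congr (_ + _).
  by rewrite -[(c j)%:R]opprK -cE opprB addrC subrK.
have floorE j : Num.floor (p%:R * v 0 j - v' 0 j) = - (c j)%:Z.
  by have [_ ->] := Hc j; rewrite -[- (c j)%:R]/(- ((c j)%:Z%:~R)) -mulrNz intrKfloor.
pose n_ j := l 0 j + (c j)%:Z.
have term (k : 'rV[nat]_N) : (\prod_(j < N) theta pi0 (k 0 j)) *
    Phi_star (Gseries a w pi0 rho d (E_of v) v beta) (e - natv k) (u - wsum a (natv k)) =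
    root_pow rho d W * \prod_(j < N)
      (theta pi0 (k 0 j) * frob (Gseq pi0 (v 0 j)) (n_ j - (k 0 j)%:Z)).
  rewrite big_split/= mulrCA; congr (_ * _).
  rewrite /Phi_star uE' -wsumB -wsumZ.
  set e' := p%:R^-1 *: (e - natv k).
  have e'j j : p%:R * e' 0 j = p%:R * v 0 j + (n_ j - (k 0 j)%:Z)%:~R.
    rewrite !mxE mulrA divff// mul1r eEj !intrD intrN; ring.
  (* If p fails to divide some n_j - k_j, then e' is not in v + Z^N and both sides vanish. *)
  have [pn|/existsNP[i pn]] := pselect (forall j, (p%:Z %| n_ j - (k 0%R j)%:Z)%Z); last first.
    have -> : \prod_(j < N) frob (Gseq pi0 (v 0 j)) (n_ j - (k 0 j)%:Z) = 0.
      by apply/eqP/prodf_eq0; exists i => //; rewrite /frob; case: ifP pn.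
    rewrite mulr0 /Gseries; case: asboolP => // _.
    rewrite Gcoef_out ?mul0r// => m _ _ me; apply: pn.
    apply/dvdzP; exists (m 0 i); apply: (@intr_inj rat).
    have := e'j i; rewrite -me !mxE mulrDr => /addrI <-.
    by rewrite intrM mulrC.
  pose m : 'rV[int]_N := \row_j ((n_ j - (k 0%R j)%:Z) %/ p%:Z)%Z.
  have mE j : n_ j - (k 0 j)%:Z = p%:Z * m 0 j by rewrite mxE mulrC divzK.
  have e'E : e' = v + ratv m.
    apply/rowP => j; apply: (mulfI pQ); rewrite e'j mE.
    by rewrite [(v + _) 0 j]mxE [ratv m 0 j]mxE mulrDr intrM.
  have frobE j : frob (Gseq pi0 (v 0 j)) (n_ j - (k 0 j)%:Z) = Gseq pi0 (v 0 j) (m 0 j).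
    by rewrite mE frob_mul.
  under eq_bigr => j _ do rewrite frobE.
  rewrite /Gseries; case: asboolP => [_|]; last first.
    by case; exists m; rewrite hbetav -wsumD e'E.
  rewrite (wform_wsum hw).
  have -> : \sum_j e' 0 j = W + (\sum_j m 0 j)%:~R.
    rewrite rmorph_sum/= -big_split/=; apply: eq_bigr => j _.
    by rewrite e'E mxE [ratv m 0 j]mxE.
  rewrite (root_powD hd hrho pi00)// (root_pow_int hrho) exprz_sum//.
  have [Em|nEm] := pselect (E_of v m).
    rewrite e'E Gcoef_mem// mulrC -mulrA; congr (_ * _).
    by rewrite mulrC -big_split.
  rewrite Gcoef_out; last first.
    move=> m' Em' _ m'e; apply: nEm; rewrite (_ : m = m')//.
    by apply/rowP => j; move: m'e; rewrite e'E => /addrI/rowP/(_ j);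
      rewrite !mxE => /intr_inj.
  rewrite mul0r; apply/esym/eqP; rewrite mulf_eq0; apply/orP; right.
  (* For m outside E: if v_j = -1, m_j > 0 is impossible since l_j <= 0; if v_j = 0, m_j < 0 makes
     g(0, m_j) vanish. So truncating G_v to E loses nothing. *)
  move/existsNP: nEm => [j]; rewrite not_andP => -[/not_implyP[vj mj]|/not_implyP[vj mj]].
    case: mj; have [cj _] := Hc j.
    have lj : l 0 j <= 0 by have [+ _] := El j; apply.
    exact: le0_of_mul lj cj (mE j).
  apply/prodf_eq0; exists j => //; rewrite /Gseq vj (g_eq0 hp) ?mul0r//.
  by rewrite ltNge; apply/negP.
rewrite /mul_theta.
under [X in sum_inf X]eq_fun do rewrite term.
rewrite (@sum_inf_prod _ _ _ _ _ (fun j k => theta pi0 k * frob (Gseq pi0 (v 0 j)) (n_ j - k%:Z))); last first.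
  move=> j; have := term_bound (overconvergent_theta hp hpi0_ord)
    (linear_growth_frob p0 (linear_growth_Gseq hp hpi0 hpi0_ord (hvp j))).
  by move=> [C [s [C0 s01 HC]]]; exists (C * (`|n_ j|%N.+1)%:R), s; split; rewrite ?mulr_ge0.
have idj j : sumn_inf (fun k => theta pi0 k * frob (Gseq pi0 (v 0 j)) (n_ j - k%:Z)) =
    H pi0 (ratr (- v 0 j)) / bracket (ratr (v' 0 j)) (- (c j)%:Z) *
    (Gseq pi0 (v' 0 j) (l 0 j) * pi0 ^ (c j)%:Z).
  have [cp cE] := Hc j; apply: (Gseq_identity hp hpi0 hpi0_ord (hv j) (hvp j) cp cE).
  by have [] := El j.
under eq_bigr => j _ do rewrite idj.
under [in RHS]eq_bigr => j _ do rewrite floorE.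
rewrite /Gseries; case: asboolP => [_|]; last by case; exists l.
rewrite uE' {1 2}eE Gcoef_mem// hbetav !(wform_wsum hw) -/W big_split/=.
have GE : \prod_j (Gseq pi0 (v' 0 j) (l 0 j) * pi0 ^ (c j)%:Z) =
    \prod_j g pi0 (v' 0 j) (l 0 j) * \prod_j pi0 ^ n_ j.
  by rewrite -big_split/=; apply: eq_bigr => j _; rewrite /Gseq -mulrA -expfzDr.
(* Both exponents are W + sum_j n_j, since sum_j e_j = p W + sum_j n_j. *)
have powE : root_pow rho d (- (p.-1%:R * W)) * root_pow rho d (\sum_j e 0 j) =
    root_pow rho d W * \prod_j pi0 ^ n_ j.
  rewrite -(exprz_sum pi00) -(root_pow_int hrho) -!(root_powD hd hrho pi00)//.
    congr root_pow; under eq_bigr => j _ do rewrite eEj -addrA [(c j)%:R + _]addrC.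
    rewrite big_split/= -mulr_sumr -/W rmorph_sum/= addrA; congr (_ + _).
      by rewrite -{2}(prednK p0) -natr1; ring.
    by apply: eq_bigr => j _; rewrite intrD.
  by rewrite mulrN mulrCA rpredN rpredM// rpred_nat.
rewrite GE; set A := root_pow rho d (- _) in powE *.
set B := \prod_j (H _ _ / _).
transitivity (A * root_pow rho d (\sum_j e 0 j) * (B * \prod_j g pi0 (v' 0 j) (l 0 j))).
  by rewrite powE; ring.
by ring.
Qed.
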